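(* Let $0\le\lambda\le1$ and let $\varphi$ be as described in the context, with $\varphi(z)=1+B_1z+B_2z^2+\cdots$. If $f(z)=z+\sum_{n\ge2}a_nz^n$ belongs to $\mathcal{G}^{\lambda}_{\sigma}(\varphi)$, then \[ |a_2|\le\begin{cases}\sqrt{\dfrac{B_1}{3-\lambda}}, & \text{if } |B_2|\le B_1,\\[3mm] \sqrt{\dfrac{|B_2|}{3-\lambda}}, & \text{if } |B_2|\ge B_1,\end{cases} \] and \[ \left|a_3-\frac{4\lambda}{3+3\lambda}a_2^2\right|\le\begin{cases}\dfrac{B_1}{3+3\lambda}, & \text{if } |B_2|\le B_1,\\[3mm] \dfrac{|B_2|}{3+3\lambda}, & \text{if } |B_2|\ge B_1.\end{cases} \]
   Context: $\mathbb{U}=\{z\in\mathbb{C}:|z|<1\}$. For analytic $f,g$ on $\mathbb{U}$, $f\prec g$ means there is an analytic $w$ on $\mathbb{U}$ with $w(0)=0$, $|w(z)|<1$, and $f(z)=g(w(z))$. The function $\varphi$ is analytic and univalent in $\mathbb{U}$ with positive real part, $\varphi(0)=1$, $\varphi'(0)>0$, $\varphi$ maps $\mathbb{U}$ onto a region starlike with respect to $1$ and symmetric with respect to the real axis; $\varphi(z)=1+B_1z+B_2z^2+\cdots$ with real coefficients and $B_1>0$. $\sigma$ denotes the class of analytic functions $f(z)=z+\sum_{n\ge2}a_nz^n$ on $\mathbb{U}$ that are univalent in $\mathbb{U}$ and whose inverse $g=f^{-1}$ is also univalent in $\mathbb{U}$. For $0\le\lambda\le1$, $\mathcal{G}^{\lambda}_{\sigma}(\varphi)$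 is the set of $f\in\sigma$ such that $(1-\lambda)f'(z)+\lambda\left(1+\frac{zf''(z)}{f'(z)}\right)\prec\varphi(z)$ for $z\in\mathbb{U}$ and $(1-\lambda)g'(w)+\lambda\left(1+\frac{wg''(w)}{g'(w)}\right)\prec\varphi(w)$ for $w\in\mathbb{U}$, where $g=f^{-1}$. *)

(* Defs.v *)
(* MathComp-Analysis over an abstract realType R, complex
   numbers are mathcomp-real-closed's  R[i]  (= complex R).  The normed
   structure used for limits / derivatives is the regular one  (R[i])^o,
   whose scalar field is R[i] itself, so  'D_1 f z  is the complex derivative. *)
From HB Require Import structures.
From mathcomp Require Import all_boot all_order all_algebra.
From mathcomp Require Import complex.
From mathcomp Require Import all_classical all_reals all_analysis.
Set Implicit Arguments. Unset Strict Implicit. Unset Printing Implicit Defensive.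
Import Order.TTheory GRing.Theory Num.Theory.
Import numFieldNormedType.Exports.
Local Open Scope ring_scope.
Local Open Scope complex_scope.
Local Open Scope classical_set_scope.

Section BiUnivalent.
Variable R : realType.
Local Notation C := ((R[i])^o).

Definition udisk : set C := [set z : C | `|z| < 1].

Definition analytic_on_U (f : C -> C) : Prop :=
  forall z : C, udisk z -> derivable f z 1.

Definition univalent_on_U (f : C -> C) : Prop :=
  forall z1 z2 : C, udisk z1 -> udisk z2 -> f z1 = f z2 -> z1 = z2.

Definition power_series_on_U (c : nat -> C) (f : C -> C) : Prop :=
  forall z : C, udisk z -> series (fun n => c n * z ^+ n) @ \oo --> f z.

Definition subordinate (p q : C -> C) : Prop :=
  exists w : C -> C,
    [/\ analytic_on_U w, w 0 = 0,
        (forall z : C, udisk z -> `|w z| < 1) &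
        (forall z : C, udisk z -> p z = q (w z))].

Definition admissible_phi (B : nat -> R) (phi : C -> C) : Prop :=
  analytic_on_U phi /\ univalent_on_U phi /\
      (forall z : C, udisk z -> 0 < Re (phi z)) /\
      phi 0 = 1 /\ 0 < 'D_1 phi 0 :> R[i] /\
      (forall (z : C) (t : R), udisk z -> 0 <= t <= 1 ->
         exists2 u : C, udisk u & phi u = 1 + t%:C * (phi z - 1)) /\
      (forall z : C, udisk z -> exists2 u : C, udisk u & phi u = conjc (phi z)) /\
      power_series_on_U (fun n => (B n)%:C) phi /\
      B 0%N = 1 /\ 0 < B 1%N.

(* f in sigma, with Taylor coefficients a (f(z) = z + sum_{n>=2} a_n z^n),
   and g the analytic univalent continuation to U of the inverse f^{-1}
   (g w in U and f (g w) = w for w near 0). *)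
Definition in_sigma (a : nat -> C) (f g : C -> C) : Prop :=
  [/\ a 0%N = 0 /\ a 1%N = 1, power_series_on_U a f,
      analytic_on_U f /\ univalent_on_U f,
      analytic_on_U g /\ univalent_on_U g &
      \forall w \near (0 : C), udisk (g w) /\ f (g w) = w].

Definition Gexpr (lam : R) (h : C -> C) : C -> C :=
  fun z => (1 - lam%:C) * 'D_1 h z
           + lam%:C * (1 + z * 'D_1 ('D_1 h) z / 'D_1 h z).

Definition in_G (lam : R) (phi : C -> C) (a : nat -> C) (f g : C -> C) : Prop :=
  [/\ in_sigma a f g, subordinate (Gexpr lam f) phi &
      subordinate (Gexpr lam g) phi].

End BiUnivalent.

(* Main.v *)
Require Import Defs.
From HB Require Import structures.
From mathcomp Require Import all_boot all_order all_algebra.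
From mathcomp Require Import complex.
From mathcomp Require Import all_classical all_reals all_analysis.
From mathcomp Require Import ring lra.
Import Order.TTheory GRing.Theory Num.Theory.
Import numFieldNormedType.Exports.
Local Open Scope ring_scope.
Local Open Scope complex_scope.
Local Open Scope classical_set_scope.
Import Normc.

Set Implicit Arguments. Unset Strict Implicit. Unset Printing Implicit Defensive.

(** If [Gexpr lam f = phi \o w] then comparing coefficients of [z ^+ 2] gives
    [(3 + 3 lam) a3 - 4 lam a2 ^+ 2 = B1 w2 + B2 w1 ^+ 2], which the
    Schwarz-Pick bound [|w2| <= 1 - |w1| ^+ 2] makes at most [max B1 |B2|].
    This is the second estimate. The inverse [g] has second and third
    coefficients [- a2] and [2 a2 ^+ 2 - a3]; adding its identity to that of [f]
    eliminates [a3] and leaves [(6 - 2 lam) a2 ^+ 2], whence the first estimate.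

    The Schwarz-Pick bound is needed for a merely complex differentiable [w].
    Goursat's subdivision argument, run on Riemann sums instead of integrals,
    shows that in log-polar coordinates the averages over [2 ^ n] equidistributed
    points of a circle tend to the value at the center. *)

(** * Goursat's theorem for dyadic Riemann sums *)

Section DyadicContour.
Variable R : realType.
Implicit Types (u v : R -> R[i]) (F : R -> R -> R[i]).

(** The subordinating function [w] and the inverse [g] are known only to be differentiable, so they
    come without Taylor coefficients to compare. [jet2] supplies these: it asks for an expansion
    [c0 + z * c1 + z ^+ 2 * r z] with [r] continuous at 0. Such an expansion of [w] or [g] follows
    from one of [phi (w z)] or [f (g z)], because the linear coefficients of [phi] and [f] are
    nonzero.

    The Schwarz-Pick bound rests on a Bessel inequality for [G z = w z / z]: on a circle of radius
    [r], the first two coefficients of [G z * (1 + t * z)] are controlled by the mean of its squared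
    modulus. Letting [r] tend to 1 and optimizing over [t] gives the bound. The mean value property
    is proved for functions differentiable off the origin with a limit there, so that the quotients
    [w z / z] and [(w z / z - w1) / z] can be used directly.

    Dyadic sums are used because they obey the subdivision identity exactly: Goursat's argument then
    has no discretization error to track. *)

Lemma normc_ge0 (z : R[i]) : 0 <= normc z.
Proof. by case: z => a b; exact: sqrtr_ge0. Qed.

Lemma normcR (x : R) : normc x%:C = `|x|.
Proof. by rewrite /normc /= expr0n addr0 sqrtr_sqr. Qed.

Lemma normc_norm (z : R[i]) : `|z| = (normc z)%:C.
Proof. by rewrite normc_def; case: z. Qed.

Lemma normci : normc 'i = 1 :> R.
Proof. by rewrite /normc /= expr0n add0r expr1n sqrtr1. Qed.

Lemma gt0_ReE (e : R[i]) : 0 < e -> e = (complex.Re e)%:C /\ 0 < complex.Re e.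
Proof.
by case: e => a b; rewrite ltcE /= => /andP[/eqP -> ].
Qed.

Definition avg n u : R[i] :=
  (2^-1)%:C ^+ n * \sum_(0 <= j < 2 ^ n) u (j%:R * 2^-1 ^+ n).

Lemma avg0 u : avg 0 u = u 0.
Proof. by rewrite /avg expr0 mul1r big_nat1 mul0r. Qed.

Lemma avgS n u : avg n.+1 u =
  (2^-1)%:C * (avg n (fun t => u (t / 2)) + avg n (fun t => u (2^-1 + t / 2))).
Proof.
rewrite /avg exprS -mulrA -mulrDr; congr (_ * (_ * _)).
rewrite expnS mul2n -addnn (big_cat_nat (n := 2 ^ n)) ?leq_addr//=; congr (_ + _).
  by apply: eq_bigr => j _; congr (u _); rewrite exprS; ring.
rewrite -{1}[X in \sum_(X <= _ < _) _]add0n big_addn addnK.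
apply: eq_bigr => j _; congr (u _); rewrite natrD natrX exprS.
have : (2:R) ^+ n * 2^-1 ^+ n = 1 by rewrite -exprMn divff// expr1n.
by move=> E; rewrite mulrDl [2 ^+ n * _]mulrCA E; ring.
Qed.

Lemma eq_avg n u v : (forall t, u t = v t) -> avg n u = avg n v.
Proof. by move=> uv; congr avg; apply/funext. Qed.

Lemma avgD n u v : avg n (fun t => u t + v t) = avg n u + avg n v.
Proof. by rewrite /avg big_split mulrDr. Qed.

Lemma avgN n u : avg n (fun t => - u t) = - avg n u.
Proof. by rewrite /avg sumrN mulrN. Qed.

Lemma avgB n u v : avg n (fun t => u t - v t) = avg n u - avg n v.
Proof. by rewrite avgD avgN. Qed.

Lemma avg_cst n (c : R[i]) : avg n (fun=> c) = c.
Proof.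
rewrite /avg sumr_const_nat subn0 -[c *+ _]mulr_natl natrX mulrA.
have -> : ((2^-1)%:C : R[i]) = 2^-1 by rewrite fmorphV rmorph_nat.
by rewrite -exprMn mulVf ?pnatr_eq0// expr1n mul1r.
Qed.

Lemma avg_le n u (M : R) :
  (forall t, 0 <= t <= 1 -> normc (u t) <= M) -> normc (avg n u) <= M.
Proof.
elim: n u => [|n IH] u uM; first by rewrite avg0 uM// lexx ler01.
rewrite avgS normcM normcR ger0_norm; last lra.
have h1 : normc (avg n (fun t => u (t / 2))) <= M by apply: IH => t ?; apply: uM; lra.
have h2 : normc (avg n (fun t => u (2^-1 + t / 2))) <= M by apply: IH => t ?; apply: uM; lra.
have := le_normcD (avg n (fun t => u (t / 2))) (avg n (fun t => u (2^-1 + t / 2))).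
lra.
Qed.

(* Left Riemann sums of [F dz] along the boundary of the rectangle with
   lower left corner (x, y) and sides h, k; opposite sides are paired. *)
Definition contour n F (x y h k : R) : R[i] :=
  h%:C * avg n (fun t => F (x + t * h) y - F (x + t * h) (y + k)) +
  'i * k%:C * avg n (fun t => F (x + h) (y + t * k) - F x (y + t * k)).

(** By [avgS], a sum of level [n.+1] along a side splits exactly into sums of level [n] along its
    halves. The inner edges are sampled at the same points from both sides and cancel. *)
Lemma contourS n F x y h k : contour n.+1 F x y h k =
  contour n F x y (h / 2) (k / 2) + contour n F (x + h / 2) y (h / 2) (k / 2) +
  contour n F x (y + k / 2) (h / 2) (k / 2) +
  contour n F (x + h / 2) (y + k / 2) (h / 2) (k / 2).
Proof.
rewrite /contour !avgS !avgB.
have e1 : forall (z : R), z + h / 2 + h / 2 = z + h by move=> z; field.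
have e2 : forall (z : R), z + k / 2 + k / 2 = z + k by move=> z; field.
rewrite !e1 !e2.
have e3 (G : R -> R[i]) z m : avg n (fun t => G (z + (2^-1 + t / 2) * m)) =
    avg n (fun t => G (z + m / 2 + t * (m / 2))).
  by apply: eq_avg => t; congr (G _); field.
have e4 (G : R -> R[i]) z m : avg n (fun t => G (z + (t / 2) * m)) =
    avg n (fun t => G (z + t * (m / 2))).
  by apply: eq_avg => t; congr (G _); field.
rewrite (e3 (F ^~ y)) (e3 (F ^~ (y+k))) (e3 (F x)) (e3 (F (x + h))).
rewrite (e4 (F ^~ y)) (e4 (F ^~ (y+k))) (e4 (F x)) (e4 (F (x + h))).
rewrite !rmorphM /=.
ring.
Qed.

(** For an affine function the difference between opposite sides is constant, so the Riemann sums
    are exact and the two pairs of sides cancel. *)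
Lemma contour_affine n (b c : R[i]) x y h k :
  contour n (fun s t => b + c * (s%:C + 'i * t%:C)) x y h k = 0.
Proof.
rewrite /contour.
rewrite (@eq_avg n _ (fun=> - (c * 'i * k%:C))); last first.
  by move=> t; cbv beta; rewrite !rmorphD; ring.
rewrite [X in _ + _ * X](@eq_avg n _ (fun=> c * h%:C)); last first.
  by move=> t; cbv beta; rewrite !rmorphD; ring.
by rewrite !avg_cst; ring.
Qed.

Lemma contourB n F G x y h k :
  contour n (fun s t => F s t - G s t) x y h k =
  contour n F x y h k - contour n G x y h k.
Proof. rewrite /contour !avgB; ring. Qed.

Lemma contour_le n F (x y h k M : R) : 0 <= h -> 0 <= k ->
  (forall s t, x <= s <= x + h -> y <= t <= y + k -> normc (F s t) <= M) ->
  normc (contour n F x y h k) <= 2 * (h + k) * M.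
Proof.
move=> h0 k0 FM; apply: le_trans (le_normcD _ _) _.
have nB (z w : R[i]) : normc z <= M -> normc w <= M -> normc (z - w) <= 2 * M.
  by move=> zM wM; have := le_normcD z (- w); rewrite normcN; lra.
rewrite normcM [normc ('i * _ * _)]normcM [normc ('i * _)]normcM normci mul1r !normcR !ger0_norm//.
have -> : 2 * (h + k) * M = h * (2 * M) + k * (2 * M) by ring.
have tm (t m : R) : 0 <= t <= 1 -> 0 <= m -> 0 <= t * m <= m.
  by move=> /andP[t0 t1] m0; rewrite mulr_ge0//= ler_piMl.
apply: lerD; apply: ler_wpM2l => //; apply: avg_le => t t01.
  have := tm _ _ t01 h0 => /andP[? ?].
  by apply: nB; apply: FM; lra.
have := tm _ _ t01 k0 => /andP[? ?].
by apply: nB; apply: FM; lra.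
Qed.

(** Complex differentiability at [x + i y], written in real coordinates and with the l1 norm. *)
Definition cdiff2 F (x y : R) := exists c : R[i], forall e : R, 0 < e ->
  exists2 d : R, 0 < d & forall s t, `|s - x| < d -> `|t - y| < d ->
    normc (F s t - F x y - c * ((s - x)%:C + 'i * (t - y)%:C))
      <= e * (`|s - x| + `|t - y|).

(** The negation of being eventually at most [e]. Asking for arbitrarily large [n] survives the loss
    of one level in [contourS]. *)
Definition contour_bad F (e x y h k : R) :=
  forall N, exists2 n, (N <= n)%N & e < normc (contour n F x y h k).

Lemma contour_bad_split F (e x y h k : R) : contour_bad F e x y h k ->
  exists i j : bool,
    contour_bad F (e / 4) (x + i%:R * (h / 2)) (y + j%:R * (k / 2)) (h / 2) (k / 2).
Proof.
move=> bad; apply: contrapT => nbad.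
have good (i j : bool) : exists N, forall n, (N <= n)%N ->
   normc (contour n F (x + i%:R * (h / 2)) (y + j%:R * (k / 2)) (h / 2) (k / 2)) <= e / 4.
  apply: contrapT => nN; apply: nbad; exists i, j => N.
  apply: contrapT => nn; apply: nN; exists N => n Nn.
  by rewrite leNgt; apply/negP => lt; apply: nn; exists n.
have [N1 H1] := good false false; have [N2 H2] := good true false.
have [N3 H3] := good false true; have [N4 H4] := good true true.
(* The [.+1] makes the bad level a successor, as [contourS] requires, with a predecessor still
   beyond all four thresholds. *)
have [[|n] Nn] := bad (maxn (maxn N1 N2) (maxn N3 N4)).+1; first by [].
move: Nn; rewrite ltnS !geq_max => /andP[/andP[n1 n2] /andP[n3 n4]].
rewrite contourS.
move: (H1 _ n1) (H2 _ n2) (H3 _ n3) (H4 _ n4); rewrite !mul0r !addr0 !mul1r.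
set A := contour _ _ _ _ _ _; set B := contour _ _ _ _ _ _.
set C := contour _ _ _ _ _ _; set D := contour _ _ _ _ _ _.
have := le_normcD (A + B + C) D; have := le_normcD (A + B) C; have := le_normcD A B.
lra.
Qed.

Lemma goursat F (x y h k : R) : 0 <= h -> 0 <= k ->
  (forall s t, x <= s <= x + h -> y <= t <= y + k -> cdiff2 F s t) ->
  forall e, 0 < e -> exists N, forall n, (N <= n)%N ->
    normc (contour n F x y h k) <= e.
Proof.
move=> h0 k0 dF e e0; apply: contrapT => nN.
have bad : contour_bad F e x y h k.
  move=> N; apply: contrapT => nn; apply: nN; exists N => n Nn.
  by rewrite leNgt; apply/negP => lt; apply: nn; exists n.
(* A state holds the lower left corner and the depth. Stating the choice as an implication makes it
   total, so that [choice] yields a function on all states. *)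
pose good_choice (q : R * R * nat) (p : bool * bool) :=
  contour_bad F (e / 4 ^+ q.2) q.1.1 q.1.2 (h / 2 ^+ q.2) (k / 2 ^+ q.2) ->
  contour_bad F (e / 4 ^+ q.2.+1) (q.1.1 + p.1%:R * (h / 2 ^+ q.2.+1))
    (q.1.2 + p.2%:R * (k / 2 ^+ q.2.+1)) (h / 2 ^+ q.2.+1) (k / 2 ^+ q.2.+1).
have /choice [ch chP] : forall q, exists p, good_choice q p.
  move=> [[u v] m]; rewrite /good_choice /=.
  have [b|nb] := pselect (contour_bad F (e / 4 ^+ m) u v (h / 2 ^+ m) (k / 2 ^+ m)).
    have [i [j]] := contour_bad_split b; exists (i, j) => _ /=.
    by rewrite !exprSr !invfM !mulrA in p *.
  by exists (false, false).
pose stp (q : R * R * nat) := (q.1.1 + (ch q).1%:R * (h / 2 ^+ q.2.+1),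
    q.1.2 + (ch q).2%:R * (k / 2 ^+ q.2.+1), q.2.+1).
pose Q m := iter m stp (x, y, 0%N).
have Qm m : (Q m).2 = m by elim: m => //= m ->.
have Qbad m : contour_bad F (e / 4 ^+ m) (Q m).1.1 (Q m).1.2 (h / 2 ^+ m) (k / 2 ^+ m).
  elim: m => [|m IH]; first by rewrite !expr0 !divr1.
  have := chP (Q m); rewrite /good_choice Qm => /(_ IH).
  by rewrite /Q iterS -/(Q m) /stp /= Qm.
have nested (z : nat -> R) (b : nat -> bool) (l : R) : 0 <= l ->
    (forall m, z m.+1 = z m + (b m)%:R * (l / 2 ^+ m.+1)) ->
    exists p, forall m, z m <= p <= z m + l / 2 ^+ m.
  move=> l0 zS.
  have l2 m : l / 2 ^+ m.+1 + l / 2 ^+ m.+1 = l / 2 ^+ m.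
    by rewrite exprSr; field; rewrite expf_neq0.
  have lp m : 0 <= l / 2 ^+ m by rewrite divr_ge0// exprn_ge0.
  have step m : z m <= z m.+1 /\ z m.+1 + l / 2 ^+ m.+1 <= z m + l / 2 ^+ m.
    by rewrite zS; have := l2 m; have := lp m.+1; case: (b m); rewrite ?mul1r ?mul0r; lra.
  have mono m n : z m <= z (m + n)%N /\ z (m + n)%N + l / 2 ^+ (m + n) <= z m + l / 2 ^+ m.
    elim: n => [|n [IH1 IH2]]; first by rewrite addn0.
    by rewrite addnS; have [] := step (m + n)%N; lra.
  have ub n m : z m <= z n + l / 2 ^+ n.
    have [mn|/ltnW nm] := leqP m n.
      by have [+ _] := mono m (n - m)%N; rewrite subnKC//; have := lp n; lra.
    by have [_] := mono n (m - n)%N; rewrite subnKC//; have := lp m; lra.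
  exists (sup (range z)) => m; apply/andP; split.
    apply: ub_le_sup; last by exists m.
    by exists (z 0 + l / 2 ^+ 0) => _ [n _ <-]; exact: ub.
  by apply: ge_sup => [|_ [n _ <-]]; [exists (z 0), 0|exact: ub].
have [p pP] : exists p, forall m, (Q m).1.1 <= p <= (Q m).1.1 + h / 2 ^+ m.
  apply: (nested (fun m => (Q m).1.1) (fun m => (ch (Q m)).1)) => // m.
  by rewrite /Q iterS -/(Q m) /stp /= Qm.
have [q qP] : exists q, forall m, (Q m).1.2 <= q <= (Q m).1.2 + k / 2 ^+ m.
  apply: (nested (fun m => (Q m).1.2) (fun m => (ch (Q m)).2)) => // m.
  by rewrite /Q iterS -/(Q m) /stp /= Qm.
have [c cP] : cdiff2 F p q.
  by apply: dF; [have := pP 0%N|have := qP 0%N]; rewrite /Q /= expr0 divr1.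
(* At depth [m] the contour is at most [2 * e' * ((h + k) / 2 ^+ m) ^+ 2], which this [e'] keeps
   below [e / 4 ^+ m]. The [+ 1] covers [h + k = 0]. *)
pose e' := e / (2 * (h + k + 1) ^+ 2).
have e'0 : 0 < e' by rewrite divr_gt0// mulr_gt0// exprn_gt0//; lra.
have [d d0 dP] := cP _ e'0.
have [m mP] : exists m, (h + k) / 2 ^+ m < d.
  have [M MP] : exists M : nat, (h + k) / d < M%:R.
    by exists (Num.truncn ((h + k) / d)).+1; rewrite truncnS_gt.
  exists M; rewrite ltr_pdivrMr ?exprn_gt0// mulrC -ltr_pdivrMr//.
  apply: lt_le_trans MP _; rewrite -natrX ler_nat; exact/ltnW/ltn_expl.
have [n _] := Qbad m 0%N; apply/negP; rewrite -leNgt.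
set u := (Q m).1.1; set v := (Q m).1.2.
have h2 : 0 <= h / 2 ^+ m by rewrite divr_ge0// exprn_ge0.
have k2 : 0 <= k / 2 ^+ m by rewrite divr_ge0// exprn_ge0.
(* Removing the first-order expansion at [(p, q)] does not change the sum, and leaves values of size
   [e'] times the half perimeter. *)
have -> : contour n F u v (h / 2 ^+ m) (k / 2 ^+ m) =
  contour n (fun s t => F s t - ((F p q - c * (p%:C + 'i * q%:C)) + c * (s%:C + 'i * t%:C)))
    u v (h / 2 ^+ m) (k / 2 ^+ m) by rewrite contourB contour_affine subr0.
apply: le_trans (contour_le n h2 k2 (M := e' * ((h + k) / 2 ^+ m)) _) _.
  move=> s t su tv.
  have := pP m; have := qP m; rewrite -/u -/v => qv pu.
  have hk : (h + k) / 2 ^+ m = h / 2 ^+ m + k / 2 ^+ m by rewrite mulrDl.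
  have sp : `|s - p| <= h / 2 ^+ m by rewrite ler_norml; lra.
  have tq : `|t - q| <= k / 2 ^+ m by rewrite ler_norml; lra.
  have := dP s t; rewrite hk in mP *.
  have -> : F s t - (F p q - c * (p%:C + 'i * q%:C) + c * (s%:C + 'i * t%:C)) =
    F s t - F p q - c * ((s - p)%:C + 'i * (t - q)%:C) by rewrite !rmorphB /=; ring.
  move=> H; apply: le_trans (H _ _) _; [lra|lra|].
  by apply: ler_wpM2l; [exact: ltW|lra].
rewrite -mulrDl.
have -> : (4 : R) ^+ m = 2 ^+ m * 2 ^+ m by rewrite -exprMn; congr (_ ^+ _); ring.
have t0 : 0 < (2:R) ^+ m by rewrite exprn_gt0.
rewrite /e'.
have -> : 2 * ((h + k) / 2 ^+ m) *
  (e / (2 * (h + k + 1) ^+ 2) * ((h + k) / 2 ^+ m)) =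
  e / (2 ^+ m * 2 ^+ m) * ((h + k) ^+ 2 / (h + k + 1) ^+ 2).
  by field; rewrite lt0r_neq0//=; lra.
rewrite ler_piMr//; first by rewrite divr_ge0// ?ltW// mulr_gt0.
by rewrite ler_pdivrMr ?exprn_gt0//; [rewrite mul1r ler_pXn2r// ?nnegrE; lra|lra].
Qed.

End DyadicContour.

(** * Mean values on circles *)

Lemma derivable_near (K : numFieldType) (f : K^o -> K^o) (x : K) :
  derivable f x 1 -> forall e : K, 0 < e -> exists2 d : K, 0 < d &
    forall y, `|y - x| < d -> `|f y - f x - 'D_1 f x * (y - x)| <= e * `|y - x|.
Proof.
move=> df e e0; have : h^-1 *: ((f \o shift x) (h *: 1) - f x) @[h --> 0^'] --> 'D_1 f x by exact: df.
move/cvgrPdist_le => /(_ e e0); rewrite near_withinE.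
case/nbhs_ballP => d /= d0 dP; exists d => // y yx.
have [->|xy] := eqVneq y x; first by rewrite !subrr mulr0 subr0 normr0 mulr0.
have /dP : ball (0 : K^o) d (y - x) by rewrite -ball_normE /= sub0r normrN.
rewrite /= subr_eq0 => /(_ xy).
rewrite /shift /= [_ *: 1]mulr1 subrK.
have y0 : 0 < `|y - x| by rewrite normr_gt0 subr_eq0.
rewrite -(ler_pM2r y0) -normrM; congr (_ <= _); rewrite -normrN; congr `|_|.
by rewrite [_ *: _]/GRing.scale /=; field; rewrite subr_eq0.
Qed.

Section Polar.
Variable R : realType.
Local Notation C := ((R[i])^o).

Definition cdiff (W : R[i] -> R[i]) (z : R[i]) := exists c : R[i], forall e : R, 0 < e ->
  exists2 d : R, 0 < d & forall y, normc (y - z) < d ->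
    normc (W y - W z - c * (y - z)) <= e * normc (y - z).

Lemma derivable_cdiff (W : C -> C) (z : C) : derivable W z 1 -> cdiff W z.
Proof.
move=> dW; exists ('D_1 W z) => e e0.
have eC : 0 < e%:C by rewrite ltcR.
have [d d0 dP] := derivable_near dW eC.
have [dE rd0] := gt0_ReE d0; exists (complex.Re d) => // y.
rewrite -ltcR -dE -normc_norm => yd.
by have := dP _ yd; rewrite !normc_norm -rmorphM lecR.
Qed.

Definition expc (s t : R) : R[i] := (expR s * cos t) +i* (expR s * sin t).

Lemma expcD s s' t t' : expc (s + s') (t + t') = expc s t * expc s' t'.
Proof.
by apply/eqP; rewrite eq_complex /= expRD cosD sinD; apply/andP; split; apply/eqP; ring.
Qed.

Lemma normc_expc s t : normc (expc s t) = expR s.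
Proof.
rewrite /expc /normc !exprMn -mulrDr cos2Dsin2 mulr1 sqrtr_sqr ger0_norm //.
Qed.

Lemma expc_2pi s t : expc s (t + 2 * pi) = expc s t.
Proof. by rewrite /expc mulr_natl cosD2pi sinD2pi. Qed.

Lemma normc_le (a b : R) : normc (a +i* b) <= `|a| + `|b|.
Proof.
have -> : a +i* b = a%:C + 'i * b%:C by rewrite [LHS]complexE.
apply: le_trans (le_normcD _ _) _; rewrite normcM !normcR.
by rewrite normci mul1r.
Qed.

Lemma expc_diff0 (e : R) : 0 < e -> exists2 d : R, 0 < d &
  forall s t, `|s| < d -> `|t| < d ->
    normc (expc s t - 1 - (s%:C + 'i * t%:C)) <= e * (`|s| + `|t|).
Proof.
(* The bound 1 ensures [expR s <= 3] below; the error terms then add up to at most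
   [6 * e' * (|s| + |t|)]. *)
move=> e0; pose e' := Num.min 1 (e / 6).
have e'0 : 0 < e' by rewrite lt_min ltr01/=; lra.
have e'1 : e' <= 1 by rewrite ge_min lexx.
have e'e : 6 * e' <= e by have : e' <= e / 6 by [rewrite ge_min lexx orbT]; lra.
clearbody e'.
have small (f : R -> R) (f' : R) : is_derive (0:R) 1 f f' -> exists2 d : R, 0 < d &
    forall y, `|y| < d -> `|f y - f 0 - f' * y| <= e' * `|y|.
  move=> [df <-]; have [d d0 dP] := derivable_near df e'0; exists d => // y.
  by move: (dP y); rewrite subr0.
have [d1 d10 d1P] := small _ _ (is_derive_expR 0).
have [d2 d20 d2P] := small _ _ (is_derive_cos 0).
have [d3 d30 d3P] := small _ _ (is_derive_sin 0).
exists (Num.min (Num.min d1 d2) (Num.min d3 e')); first by rewrite !lt_min d10 d20 d30 e'0.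
move=> s t; rewrite !lt_min => /andP[/andP[s1 s2] /andP[s3 s4]] /andP[/andP[t1 t2] /andP[t3 t4]].
have := d1P s s1; have := d2P t t2; have := d3P t t3.
rewrite sin0 cos0 expR0 !oppr0 mul0r !subr0 addr0 !mul1r => hs hc he.
have -> : expc s t - 1 - (s%:C + 'i * t%:C) =
  (expR s * (cos t - 1) + (expR s - 1 - s)) +i* (expR s * (sin t - t) + (expR s - 1) * t).
  by apply/eqP; rewrite eq_complex /=; apply/andP; split; apply/eqP; ring.
apply: le_trans (normc_le _ _) _.
have E1 : `|expR s - 1| <= 2 * `|s|.
  have -> : expR s - 1 = (expR s - 1 - s) + s by ring.
  by apply: le_trans (ler_normD _ _) _; have := normr_ge0 s; nra.
have E2 : expR s <= 3 by move: E1; rewrite ler_norml; lra.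
have E0 : 0 <= expR s by exact: expR_ge0.
have n1 : `|expR s * (cos t - 1)| <= 3 * (e' * `|t|).
  by rewrite normrM (ger0_norm E0); apply: ler_pM.
have n2 : `|expR s * (sin t - t)| <= 3 * (e' * `|t|).
  by rewrite normrM (ger0_norm E0); apply: ler_pM.
have n3 : `|(expR s - 1) * t| <= 2 * `|s| * e'.
  by rewrite normrM; apply: ler_pM => //; exact: ltW.
have := ler_normD (expR s * (cos t - 1)) (expR s - 1 - s).
have := ler_normD (expR s * (sin t - t)) ((expR s - 1) * t).
have := normr_ge0 s; have := normr_ge0 t; nra.
Qed.

Lemma expc_cdiff2 x y (e : R) : 0 < e -> exists2 d : R, 0 < d &
  forall s t, `|s - x| < d -> `|t - y| < d ->
    normc (expc s t - expc x y - expc x y * ((s - x)%:C + 'i * (t - y)%:C))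
      <= e * (`|s - x| + `|t - y|).
Proof.
move=> e0; have [|d d0 dP] := @expc_diff0 (e / expR x).
  by rewrite divr_gt0// expR_gt0.
exists d => // s t sx ty.
have -> : expc s t = expc x y * expc (s - x) (t - y) by rewrite -expcD !subrKC.
have -> : expc x y * expc (s - x) (t - y) - expc x y - expc x y * ((s - x)%:C + 'i * (t - y)%:C)
  = expc x y * (expc (s - x) (t - y) - 1 - ((s - x)%:C + 'i * (t - y)%:C)) by ring.
rewrite normcM normc_expc.
have := dP _ _ sx ty; rewrite -(ler_pM2l (expR_gt0 x)).
by rewrite [expR x * (e / _ * _)]mulrA [expR x * _]mulrC divfK// gt_eqF ?expR_gt0.
Qed.

Lemma cdiff2_expc (W : R[i] -> R[i]) x y :
  cdiff W (expc x y) -> cdiff2 (fun s t => W (expc s t)) x y.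
Proof.
move=> [c cP]; pose z := expc x y; exists (c * z) => e e0.
pose M := normc z + 1.
have M1 : 1 <= M by rewrite /M; have := normc_ge0 z; lra.
pose K := 2 * M + normc c + 1.
have K0 : 1 <= K by rewrite /K; have := normc_ge0 c; lra.
pose e' := Num.min 1 (e / K).
have e'0 : 0 < e' by rewrite lt_min ltr01/= divr_gt0//; lra.
have e'1 : e' <= 1 by rewrite ge_min lexx.
have e'e : K * e' <= e.
  by rewrite mulrC -ler_pdivlMr ?ge_min ?lexx ?orbT//; lra.
clearbody e'.
have [d1 d10 d1P] := cP _ e'0.
have [d2 d20 d2P] := expc_cdiff2 x y e'0.
(* Then [2 * M * N < d1] for the [N] below, which puts [expc s t] within [d1] of [z]. *)
exists (Num.min d2 (d1 / (4 * M))); first by rewrite lt_min d20 divr_gt0//; lra.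
move=> s t; rewrite !lt_min => /andP[s1 s2] /andP[t1 t2].
set u := (s - x)%:C + 'i * (t - y)%:C; set N := `|s - x| + `|t - y|.
have N0 : 0 <= N by rewrite addr_ge0.
have uN : normc u <= N.
  apply: le_trans (le_normcD _ _) _; rewrite normcM !normcR.
  by rewrite normci mul1r.
have h2 : normc (expc s t - z - z * u) <= e' * N by exact: d2P.
have h3 : normc (expc s t - z) <= 2 * M * N.
  have -> : expc s t - z = (expc s t - z - z * u) + z * u by ring.
  apply: le_trans (le_normcD _ _) _; rewrite normcM.
  have : normc z * normc u <= M * N by apply: ler_pM; rewrite ?normc_ge0// /M; lra.
  by nra.
have h1 : normc (W (expc s t) - W z - c * (expc s t - z)) <= e' * normc (expc s t - z).
  apply: d1P; apply: le_lt_trans h3 _.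
  move: s2 t2; rewrite !ltr_pdivlMr ?mulr_gt0//; try lra.
  by rewrite /N; nra.
have -> : W (expc s t) - W (expc x y) - c * z * u =
  (W (expc s t) - W z - c * (expc s t - z)) + c * (expc s t - z - z * u) by rewrite -/z; ring.
apply: le_trans (le_normcD _ _) _; rewrite [normc (c * _)]normcM.
have h4 : normc c * normc (expc s t - z - z * u) <= normc c * (e' * N).
  by apply: ler_wpM2l => //; exact: normc_ge0.
have h5 : e' * normc (expc s t - z) <= e' * (2 * M * N) by apply: ler_wpM2l => //; exact: ltW.
have : K * e' * N <= e * N by exact: ler_wpM2r.
by rewrite /K; nra.
Qed.

Definition circle_avg n (W : R[i] -> R[i]) (s : R) :=
  avg n (fun t => W (expc s (t * (2 * pi)))).

(** Goursat on the rectangle with sides [s1 - s0] and [2 * pi]: the horizontal sides cancel by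
    periodicity, and the vertical ones give [2 * pi * 'i] times the difference of the averages. *)
Lemma circle_avg_indep (W : R[i] -> R[i]) (s0 s1 : R) : s0 <= s1 -> s1 < 0 ->
  (forall z, 0 < normc z < 1 -> cdiff W z) ->
  forall e, 0 < e -> exists N, forall n, (N <= n)%N ->
    normc (circle_avg n W s1 - circle_avg n W s0) <= e.
Proof.
move=> s01 s10 dW e e0.
have pi0 : 0 < 2 * pi :> R by rewrite mulr_gt0// pi_gt0.
have [||||N NP] := @goursat R (fun s t => W (expc s t)) s0 0 (s1 - s0) (2 * pi) _ _ _ (e * (2 * pi)).
- by rewrite subr_ge0.
- exact: ltW.
- move=> s t ss _; apply: cdiff2_expc; apply: dW.
  by rewrite normc_expc expR_gt0/= -expR0 ltr_expR; lra.
- by rewrite mulr_gt0.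
exists N => n /NP; rewrite /contour.
rewrite (@eq_avg R n _ (fun=> 0)); last by move=> t; rewrite add0r -[2 * pi]add0r expc_2pi subrr.
rewrite avg_cst mulr0 add0r subrKC avgB.
rewrite !normcM normcR normci mul1r.
rewrite gtr0_norm// mulrC ler_pM2r//.
by rewrite /circle_avg; congr (normc (_ - _) <= _); apply: eq_avg => t; rewrite add0r.
Qed.

Lemma circle_avg_lim (W : R[i] -> R[i]) (s : R) (L : R[i]) : s < 0 ->
  (forall z, 0 < normc z < 1 -> cdiff W z) ->
  (forall e, 0 < e -> exists2 d, 0 < d & forall z, 0 < normc z < d -> normc (W z - L) <= e) ->
  forall e, 0 < e -> exists N, forall n, (N <= n)%N ->
    normc (circle_avg n W s - L) <= e.
Proof.
move=> s0 dW LW e e0.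
have e2 : 0 < e / 2 by lra.
have [d d0 dP] := LW _ e2.
(* The inner circle is fixed first, inside the disc where [W] is close to [L]; only then is the
   level [N] chosen. *)
pose s' := Num.min s (ln d - 1).
have s's : s' <= s by rewrite ge_min lexx.
have s'd : expR s' < d.
  have : s' <= ln d - 1 by rewrite ge_min lexx orbT.
  rewrite -[X in _ < X]lnK ?posrE// ltr_expR; lra.
have [N NP] := circle_avg_indep s's s0 dW e2.
exists N => n Nn.
have -> : circle_avg n W s - L = (circle_avg n W s - circle_avg n W s') + (circle_avg n W s' - L) by ring.
apply: le_trans (le_normcD _ _) _; have := NP _ Nn.
have : normc (circle_avg n W s' - L) <= e / 2.
  rewrite -[X in _ - X](avg_cst n L) -avgB; apply: avg_le => t _; apply: dP.
  by rewrite normc_expc expR_gt0.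
by lra.
Qed.

Lemma Re_le_normc (z : R[i]) : complex.Re z <= normc z.
Proof.
case: z => a b /=; apply: le_trans (ler_norm a) _.
by rewrite -sqrtr_sqr ler_wsqrtr// lerDl sqr_ge0.
Qed.

Lemma Re_avg_le n (u : R -> R[i]) (K : R) :
  (forall t, complex.Re (u t) <= K) -> complex.Re (avg n u) <= K.
Proof.
elim: n u => [|n IH] u uK; first by rewrite avg0.
rewrite avgS.
have := IH _ (fun t => uK (t / 2)); have := IH _ (fun t => uK (2^-1 + t / 2)).
by case: (avg _ _) => a b; case: (avg _ _) => c d /=; lra.
Qed.

(* The value at the puncture is the limit of averages over equidistributed
   points of the circle, since log-polar coordinates turn the annulus into a
   rectangle whose vertical sides carry these averages. *)
Lemma Re_max_principle (W : R[i] -> R[i]) (r K : R) (L : R[i]) : 0 < r < 1 ->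
  (forall z, 0 < normc z < 1 -> cdiff W z) ->
  (forall e, 0 < e -> exists2 d, 0 < d & forall z, 0 < normc z < d -> normc (W z - L) <= e) ->
  (forall z, normc z = r -> complex.Re (W z) <= K) -> complex.Re L <= K.
Proof.
move=> /andP[r0 r1] dW LW WK; apply/ler_addgt0Pr => e e0.
have lr : ln r < 0 by rewrite ln_lt0// r0.
have [N NP] := circle_avg_lim lr dW LW e0.
have := NP N (leqnn _).
have : complex.Re (circle_avg N W (ln r)) <= K.
  by apply: Re_avg_le => t; apply: WK; rewrite normc_expc lnK.
have := Re_le_normc (L - circle_avg N W (ln r)); rewrite -normcN opprB.
by case: (circle_avg _ _ _) => a b; case: (L) => c d /=; lra.
Qed.

End Polar.

(** * The Schwarz-Pick bound on the second coefficient *)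

Section Cont0.
Variable K : numFieldType.
Implicit Types F G : K^o -> K^o.

Definition cont0 F := {for (0 : K^o), continuous F}.

Let nbhs0 : Filter (nbhs (0 : K^o)) := nbhs_filter _.

Lemma cont0_cst (c : K) : cont0 (fun=> c).
Proof. exact: (@cvg_cst _ (c : K^o) _ _ nbhs0). Qed.

Lemma cont0_id : cont0 (fun z => z).
Proof. exact: (@cvg_id _ (nbhs (0 : K^o))). Qed.

Lemma cont0D F G : cont0 F -> cont0 G -> cont0 (fun z => F z + G z).
Proof. exact: (@cvgD _ K^o _ _ nbhs0). Qed.

Lemma cont0N F : cont0 F -> cont0 (fun z => - F z).
Proof. exact: (@cvgN _ K^o _ _ nbhs0). Qed.

Lemma cont0M F G : cont0 F -> cont0 G -> cont0 (fun z => F z * G z).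
Proof. exact: (@cvgM _ _ _ nbhs0). Qed.

Lemma cont0V F : cont0 F -> F 0 != 0 -> cont0 (fun z => (F z)^-1).
Proof. by move=> cF F0; exact: (@cvgV _ _ _ nbhs0). Qed.

Lemma cont0_mul (c : K) : cont0 (fun z => c * z).
Proof. exact (@cont0M (fun=> c) (fun z => z) (@cont0_cst c) (@cont0_id)). Qed.

Lemma cont0X n F : cont0 F -> cont0 (fun z => F z ^+ n).
Proof.
elim: n => [|n IH] cF; first exact: cont0_cst.
rewrite (_ : (fun z => _) = fun z => F z * F z ^+ n); last by apply/funext => z; rewrite exprS.
by apply: cont0M => //; exact: IH.
Qed.

Lemma cont0_comp F G : G 0 = 0 -> cont0 F -> cont0 G -> cont0 (fun z => F (G z)).
Proof.
move=> G0 cF cG; apply: (@continuous_comp _ _ _ G F 0 cG).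
by rewrite G0.
Qed.

Lemma derivable_cont0 F : derivable F 0 1 -> cont0 F.
Proof. by move/derivable1_diffP/differentiable_continuous. Qed.

(** Keeping the remainder as a factor continuous at 0 reduces each operation on jets to a ring
    identity plus a continuity check. *)
Definition jet2 F (c0 c1 c2 : K) := exists r : K^o -> K^o,
  [/\ cont0 r, r 0 = c2 & \forall z \near (0 : K^o), F z = c0 + z * c1 + z ^+ 2 * r z].

End Cont0.

(* The [*%R t] case catches eta-reduced products. *)
Ltac cont := lazymatch goal with
  | |- cont0 (fun z => z) => apply: cont0_id
  | |- cont0 (fun _ => ?c) => apply: cont0_cst
  | |- cont0 (GRing.mul ?t) => apply: cont0_mul
  | |- cont0 (fun z => (@?F z + @?G z)%R) => apply: cont0D; cont
  | |- cont0 (fun z => (- @?F z)%R) => apply: cont0N; cont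
  | |- cont0 (fun z => (@?F z * @?G z)%R) => apply: cont0M; cont
  | |- cont0 (fun z => (@?F z ^+ ?n)%R) => apply: cont0X; cont
  | |- cont0 (fun z => (@?F z)^-1%R) => apply: cont0V; [cont|]
  | |- _ => try solve [trivial]
  end.

Section Schwarz.
Variable R : realType.
Local Notation C := ((R[i])^o).

Lemma punctured_lim (W Phi : C -> C) : cont0 Phi ->
  (\forall z \near (0 : C), z != 0 -> W z = Phi z) ->
  forall e : R, 0 < e -> exists2 d : R, 0 < d & forall z : R[i], 0 < normc z < d ->
    normc (W z - Phi 0) <= e.
Proof.
move=> /cvgrPdist_le cP WP e e0.
have eC : 0 < e%:C by rewrite ltcR.
have : \forall z \near (0:C), z != 0 -> `|W z - Phi 0| <= e%:C.
  by near=> z => z0; rewrite (near WP z)// distrC; near: z; exact: cP.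
case/nbhs_ballP => d /= d0 dP.
have [dE rd0] := gt0_ReE d0; exists (complex.Re d) => // z /andP[z0 zd].
have /dP : ball (0 : C) d z by rewrite -ball_normE /= sub0r normrN normc_norm dE ltcR.
rewrite normc_norm lecR; apply; apply: contraTneq z0 => ->.
by rewrite normc0 ltxx.
Unshelve. all: by end_near. Qed.

(** The hypothesis says that the Toeplitz matrix with rows [(u, 0)] and [(v, u)] does not increase
    the norm of any vector [(1, t)]. *)
Lemma schur_toeplitz (u v : R[i]) :
  (forall t, normc u ^+ 2 + normc (v + t * u) ^+ 2 <= 1 + normc t ^+ 2) ->
  normc v + normc u ^+ 2 <= 1.
Proof.
move=> H; have := H 0; rewrite mul0r addr0 normc0 expr0n addr0 /=.
have [->|v0] := eqVneq v 0; first by rewrite normc0 expr0n/=; lra.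
have [->|u0] := eqVneq u 0.
  by rewrite normc0 expr0n/=; have := normc_ge0 v; nra.
have p0 : 0 < normc u.
  by rewrite lt_neqAle normc_ge0 andbT eq_sym; apply: contra u0 => /eqP/eq0_normc ->.
have q0 : 0 < normc v.
  by rewrite lt_neqAle normc_ge0 andbT eq_sym; apply: contra v0 => /eqP/eq0_normc ->.
have {}H (s : R) : 0 <= s -> normc u ^+ 2 + (normc v + s * normc u) ^+ 2 <= 1 + s ^+ 2.
  (* This [t] has modulus [s] and turns [t * u] into the direction of [v], so that the moduli
     add. *)
  move=> s0; have := H ((s * normc u / normc v)%:C * v / u).
  rewrite divfK//; have -> : v + (s * normc u / normc v)%:C * v =
    (1 + s * normc u / normc v)%:C * v by rewrite rmorphD /=; ring.
  rewrite !normcM normcV !normcR !ger0_norm; last 2 first.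
  - by rewrite divr_ge0 ?mulr_ge0 ?normc_ge0.
  - by rewrite addr_ge0// divr_ge0 ?mulr_ge0 ?normc_ge0.
  have -> : (1 + s * normc u / normc v) * normc v = normc v + s * normc u.
    by field; rewrite gt_eqF.
  by have -> : s * normc u / normc v * normc v / normc u = s by field; rewrite !gt_eqF.
move: (normc u) (normc v) p0 q0 H => p q p0 q0 H pq.
have p1 : 0 < 1 - p ^+ 2 by nra.
(* The minimizer of [1 + s ^+ 2 - (p ^+ 2 + (q + s * p) ^+ 2)] in [s]. *)
have := H (p * q / (1 - p ^+ 2)).
set s := p * q / (1 - p ^+ 2); have sE : s * (1 - p ^+ 2) = p * q by rewrite divfK// gt_eqF.
have s0 : 0 <= s by rewrite divr_ge0 ?mulr_ge0 ?ltW.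
move=> /(_ s0) Hs; have {}Hs : p ^+ 2 + q ^+ 2 + s * (p * q) <= 1 by rewrite -sE in Hs *; nra.
(* Multiplied by [1 - p ^+ 2], the inequality [Hs] loses [s] through [sE], and the terms in
   [p ^+ 2 * q ^+ 2] cancel. *)
have : q ^+ 2 <= (1 - p ^+ 2) ^+ 2.
  have : 0 <= (1 - (p ^+ 2 + q ^+ 2 + s * (p * q))) * (1 - p ^+ 2) by rewrite mulr_ge0; lra.
  have -> : (1 - (p ^+ 2 + q ^+ 2 + s * (p * q))) * (1 - p ^+ 2) =
     (1 - p ^+ 2 - q ^+ 2) * (1 - p ^+ 2) - (s * (1 - p ^+ 2)) * (p * q) by ring.
  by rewrite sE; nra.
rewrite ler_pXn2r// ?nnegrE; lra.
Qed.

Lemma sqr_normc (z : R[i]) : normc z ^+ 2 = complex.Re z ^+ 2 + complex.Im z ^+ 2.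
Proof. by case: z => a b; rewrite /normc sqr_sqrtr// addr_ge0 ?sqr_ge0. Qed.

(* On [normc z = r] one has [conjc z = r ^+ 2 / z], so that with [G := w z / z]
   the square [normc (G (1 + t z) - (w1 + b z)) ^+ 2 >= 0] and
   [normc G <= r^-1] bound the real part of a function [W] that is
   differentiable off the origin. *)
Lemma bessel_circle (r : R) (w : C -> C) (w1 w2 t : C) : 0 < r < 1 ->
  analytic_on_U w -> (forall z, udisk z -> `|w z| < 1) -> jet2 w 0 w1 w2 ->
  normc w1 ^+ 2 + r ^+ 2 * normc (w2 + t * w1) ^+ 2 <= r ^- 2 + normc t ^+ 2.
Proof.
move=> r01 aw wU [rho [crho rho0 wE]].
have r0 : 0 < r by case/andP: r01.
set b := w2 + t * w1.
pose s : C := (r ^- 2)%:C.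
pose q : C := (r ^+ 2)%:C.
(* The terms [- w1] and [- 2 * s * t * z] absorb the cross terms of the squared moduli of
   [w1 + b * z] and [1 + t * z]; [- w1] also removes the pole at 0. *)
pose W (z : C) : C := 2 * (conjc w1 * (w z / z) * (1 + t * z) +
   conjc b * q * ((w z / z - w1) / z + t * (w z / z))) - 2 * s * t * z.
(* [W] with [w z / z] rewritten through the jet of [w]: its continuous extension to the origin. *)
pose Phi (z : C) : C := 2 * (conjc w1 * (w1 + z * rho z) * (1 + t * z) +
   conjc b * q * (rho z + t * (w1 + z * rho z))) - 2 * s * t * z.
pose K := r ^- 2 * (1 + normc t ^+ 2 * r ^+ 2) + normc w1 ^+ 2 + normc b ^+ 2 * r ^+ 2.
suff : complex.Re (Phi 0) <= K.
  rewrite /Phi rho0 !mul0r !mulr0 !addr0 mulr1 subr0 -/b.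
  have -> : 2 * (conjc w1 * w1 + conjc b * q * b) =
    (2 * (normc w1 ^+ 2 + r ^+ 2 * normc b ^+ 2))%:C.
    rewrite !sqr_normc /q; case: (w1) => ? ?; case: (b) => ? ?.
    by apply/eqP; rewrite eq_complex /=; apply/andP; split; apply/eqP; ring.
  have rV : r ^- 2 * r ^+ 2 = 1 by rewrite mulVf// expf_neq0// gt_eqF.
  have -> : K = r ^- 2 + normc t ^+ 2 * (r ^- 2 * r ^+ 2) + normc w1 ^+ 2 + normc b ^+ 2 * r ^+ 2.
    by rewrite /K; ring.
  by rewrite rV /=; lra.
have z0 (z : R[i]) : 0 < normc z -> z != 0.
  by apply: contraTneq => ->; rewrite normc0 ltxx.
apply: (@Re_max_principle _ W r) => //.
- move=> z /andP[/z0 zn0 z1]; apply: derivable_cdiff.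
  have dw : derivable w z 1 by apply: aw; rewrite /udisk /= normc_norm ltcR.
  have di : derivable (fun z : C => z) z 1 by exact: derivable_id.
  have dV : derivable (fun z : C => z^-1) z 1 by exact: derivableV.
  have dc (c : C) : derivable ((fun=> c) : C -> C) (z : C) 1 by exact: derivable_cst.
  have dM (F G : C -> C) : derivable F z 1 -> derivable G z 1 ->
    derivable (fun y => F y * G y : C) z 1 by exact: (@derivableM R[i] C).
  have dD (F G : C -> C) : derivable F z 1 -> derivable G z 1 ->
    derivable (fun y => F y + G y : C) z 1 by exact: derivableD.
  have dN (F : C -> C) : derivable F z 1 -> derivable (fun y => - F y : C) z 1.
    exact: derivableN.
  have dG := dM _ _ dw dV.
  have d1 := dM _ _ (dM _ _ (dc (conjc w1)) dG) (dD _ _ (dc 1) (dM _ _ (dc t) di)).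
  have d2 := dD _ _ (dM _ _ (dD _ _ dG (dc (- w1))) dV) (dM _ _ (dc t) dG).
  have d3 := dM _ _ (dc 2) (dD _ _ d1 (dM _ _ (dc (conjc b * q)) d2)).
  exact: (dD _ _ d3 (dN _ (dM _ _ (dc (2 * s * t)) di))).
- apply: punctured_lim; first by rewrite /Phi; cont.
  near=> z => zn0; rewrite /W /Phi.
  have -> : w z = z * (w1 + z * rho z) by rewrite (near wE z)//; ring.
  by field; rewrite zn0 fmorph_eq0 gt_eqF.
- move=> z zr; have zn0 : z != 0 by apply: z0; rewrite zr.
  have zU : udisk z by rewrite /udisk /= normc_norm ltcR zr; case/andP: r01.
  have zV : z^-1 = conjc z * s.
    apply: (mulfI zn0); rewrite divff// mulrA.
    have -> : z * conjc z = (normc z ^+ 2)%:C.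
      rewrite sqr_normc; case: (z) => ? ?.
      by apply/eqP; rewrite eq_complex /=; apply/andP; split; apply/eqP; ring.
    by rewrite zr -rmorphM /= divff// expf_neq0// gt_eqF.
  rewrite /W; set G := w z / z.
  have -> : conjc b * q * ((G - w1) / z + t * G) =
     conjc b * ((G - w1) * conjc z + q * t * G).
    have : q * s = 1 by rewrite -rmorphM /= divff// expf_neq0// gt_eqF.
    by move=> qs; rewrite zV; rewrite -[(G - w1) * conjc z]mulr1 -qs; ring.
  have G1 : 0 <= r ^- 2 - normc G ^+ 2.
    rewrite subr_ge0 /G normcM normcV zr exprMn exprVn ler_piMl ?invr_ge0 ?exprn_ge0 ?ltW//.
    have := wU _ zU; rewrite normc_norm ltcR; have := normc_ge0 (w z); nra.
  have := mulr_ge0 G1 (sqr_ge0 (normc (1 + t * z))).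
  have := sqr_ge0 (normc (G * (1 + t * z) - (w1 + b * z))).
  have rE : r ^+ 2 = normc z ^+ 2 by rewrite zr.
  rewrite /K /s /q; move: (r ^- 2) => ri; rewrite rE !sqr_normc.
  case: (z) => x y; case: (t) => t1 t2; case: (G) => g1 g2; case: (w1) => a1 a2.
  case: (b) => b1 b2 /= hA hB.
  (* [K] minus the real part of [W z] is exactly the sum of the two nonnegative quantities. *)
  rewrite -subr_ge0; apply: le_trans (addr_ge0 hA hB) _.
  by rewrite le_eqVlt; apply/orP; left; apply/eqP; ring.
Unshelve. all: by end_near. Qed.

Lemma radius_limit (a b c : R) : 0 <= a -> 0 <= b -> 0 <= c ->
  (forall r, 0 < r < 1 -> a + r ^+ 2 * b <= r ^- 2 + c) -> a + b <= 1 + c.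
Proof.
move=> a0 b0 c0 H.
rewrite leNgt; apply/negP => lt; pose d := a + b - (1 + c).
have d0 : 0 < d by rewrite /d; lra.
(* With [x = r ^+ 2], multiplying the hypothesis by [x] gives [d <= (1 - x) * (a + 2 * b)], while
   this [x] makes the right side at most [d / 2]. *)
pose x := Num.max (1 / 2) (1 - d / (2 * (a + 2 * b + 1))).
have x1 : x < 1.
  by rewrite gt_max; apply/andP; split; [lra|rewrite ltrBlDr ltrDl divr_gt0//; lra].
have x0 : 1 / 2 <= x by rewrite le_max lexx.
have x2 : (1 - x) * (a + 2 * b + 1) <= d / 2.
  have : 1 - x <= d / (2 * (a + 2 * b + 1)) by rewrite lerBlDr -lerBlDl le_max lexx orbT.
  by rewrite ler_pdivlMr; lra.
have xr : Num.sqrt x ^+ 2 = x by rewrite sqr_sqrtr; lra.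
have /H : 0 < Num.sqrt x < 1.
  have s1 : Num.sqrt x < Num.sqrt 1 by rewrite ltr_sqrt.
  by rewrite sqrtr1 in s1; rewrite s1 sqrtr_gt0; lra.
rewrite xr => H'.
have : x * (a + x * b) <= 1 + x * c.
  have -> : 1 + x * c = x * (x^-1 + c) by field; rewrite gt_eqF//; lra.
  by apply: ler_wpM2l => //; lra.
have y0 : 0 <= 1 - x by lra.
have := mulr_ge0 (mulr_ge0 y0 y0) b0; have := mulr_ge0 y0 c0.
by clearbody x; rewrite /d in x2; nra.
Qed.

Lemma schwarz_second (w : C -> C) (w1 w2 : C) :
  analytic_on_U w -> (forall z, udisk z -> `|w z| < 1) -> jet2 w 0 w1 w2 ->
  normc w2 + normc w1 ^+ 2 <= 1.
Proof.
move=> aw wU wj; apply: schur_toeplitz => t.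
apply: radius_limit; try exact: sqr_ge0.
by move=> r r01; exact: bessel_circle r01 aw wU wj.
Qed.

End Schwarz.

(** * Second-order jets *)

Section Jets.
Variable K : numFieldType.
Implicit Types (F G u : K^o -> K^o) (c d : K).

Lemma near_eq_cont0 F G : cont0 F -> (\forall z \near (0 : K^o), F z = G z) -> cont0 G.
Proof.
move=> cF FG; have G0 : F 0 = G 0 by exact: nbhs_singleton FG.
rewrite /cont0 /prop_for /continuous_at -G0.
by apply: cvg_trans cF; apply: (@near_eq_cvg _ _ _ (nbhs_filter (0 : K^o))).
Qed.

Lemma near_eq_jet2 F G c0 c1 c2 : jet2 F c0 c1 c2 ->
  (\forall z \near (0 : K^o), F z = G z) -> jet2 G c0 c1 c2.
Proof.
move=> [r [cr r0 FE]] FG; exists r; split => //.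
by near=> z; rewrite -(near FG z)// (near FE z).
Unshelve. all: by end_near. Qed.

Lemma jet2_cont0 F c0 c1 c2 : jet2 F c0 c1 c2 -> cont0 F.
Proof.
move=> [r [cr _ FE]].
apply: (@near_eq_cont0 (fun z => c0 + z * c1 + z ^+ 2 * r z)); first by cont.
by near=> z; rewrite (near FE z).
Unshelve. all: by end_near. Qed.

Lemma jet2_at0 F c0 c1 c2 : jet2 F c0 c1 c2 -> F 0 = c0.
Proof. by move=> [r [_ _ /nbhs_singleton ->]]; rewrite mul0r expr0n mul0r !addr0. Qed.

Lemma jet2_cst (c : K) : jet2 (fun=> c) c 0 0.
Proof.
exists (fun=> 0); split; [exact: cont0_cst|by []|].
by near=> z; rewrite !mulr0 !addr0.
Unshelve. all: by end_near. Qed.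

Lemma jet2_id : jet2 (fun z : K^o => z) 0 1 0.
Proof.
exists (fun=> 0); split; [exact: cont0_cst|by []|].
by near=> z; rewrite mulr0 mulr1 addr0 add0r.
Unshelve. all: by end_near. Qed.

Lemma jet2D F G c0 c1 c2 d0 d1 d2 : jet2 F c0 c1 c2 -> jet2 G d0 d1 d2 ->
  jet2 (fun z => F z + G z) (c0 + d0) (c1 + d1) (c2 + d2).
Proof.
move=> [r [cr r0 FE]] [s [cs s0 GE]]; exists (fun z => r z + s z).
split; [by cont|by rewrite r0 s0|].
by near=> z; rewrite (near FE z)// (near GE z)//; ring.
Unshelve. all: by end_near. Qed.

Lemma jet2M F G c0 c1 c2 d0 d1 d2 : jet2 F c0 c1 c2 -> jet2 G d0 d1 d2 ->
  jet2 (fun z => F z * G z) (c0 * d0) (c0 * d1 + c1 * d0) (c0 * d2 + c1 * d1 + c2 * d0).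
Proof.
move=> [r [cr r0 FE]] [s [cs s0 GE]].
exists (fun z => c0 * s z + c1 * d1 + r z * d0 + z * (c1 * s z + r z * d1) + z ^+ 2 * r z * s z).
split; [by cont|by rewrite r0 s0 expr0n /= !mul0r !addr0|].
by near=> z; rewrite (near FE z)// (near GE z)//; ring.
Unshelve. all: by end_near. Qed.

Lemma near_cont0_neq0 F : cont0 F -> F 0 != 0 -> \forall z \near (0 : K^o), F z != 0.
Proof.
move=> cF F0; have nF : `|F 0| > 0 by rewrite normr_gt0.
have /cvgrPdist_lt/(_ _ nF) H : F z @[z --> (0 : K^o)] --> F 0 by exact: cF.
near=> z; apply: contraTneq (near H z _) => // ->; rewrite subr0 ltxx.
Unshelve. all: by end_near. Qed.

Lemma jet2V F c0 c1 c2 : c0 != 0 -> jet2 F c0 c1 c2 ->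
  jet2 (fun z => (F z)^-1) c0^-1 (- c1 / c0 ^+ 2) ((c1 ^+ 2 - c0 * c2) / c0 ^+ 3).
Proof.
move=> c0n jF; have cF := jet2_cont0 jF; have F0 := jet2_at0 jF.
have Fn : F 0 != 0 by rewrite F0.
have FV := near_cont0_neq0 cF Fn.
move: jF => [r [cr r0 FE]].
exists (fun z => (c1 ^+ 2 - c0 * r z + c1 * z * r z) * (F z)^-1 * c0 ^- 2).
split.
- by cont.
- by rewrite r0 F0; field.
- near=> z; have Fz : F z != 0 by near: z.
  have E : F z = c0 + z * c1 + z ^+ 2 * r z by near: z.
  by rewrite E in Fz *; field; rewrite Fz c0n.
Unshelve. all: by end_near. Qed.

Lemma cont0_near G (P : K^o -> Prop) : cont0 G -> G 0 = 0 ->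
  (\forall z \near (0 : K^o), P z) -> \forall z \near (0 : K^o), P (G z).
Proof. by move=> cG G0 HP; apply: (cG P); rewrite G0. Qed.

Lemma jet2_comp F G c0 c1 c2 d1 d2 : jet2 F c0 c1 c2 -> jet2 G 0 d1 d2 ->
  jet2 (fun z => F (G z)) c0 (c1 * d1) (c1 * d2 + c2 * d1 ^+ 2).
Proof.
move=> jF jG; have cG := jet2_cont0 jG; have G0 := jet2_at0 jG.
move: jF jG => [r [cr r0 FE]] [s [cs s0 GE]].
exists (fun z => c1 * s z + (d1 + z * s z) ^+ 2 * r (G z)); split.
- by cont; apply: cont0_comp.
- by rewrite G0 s0 r0; ring.
- have FG : \forall z \near (0 : K^o), F (G z) = c0 + G z * c1 + G z ^+ 2 * r (G z).
    exact: cont0_near FE.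
  near=> z; rewrite (near FG z)//.
  have -> : G z = 0 + z * d1 + z ^+ 2 * s z by near: z.
  by ring.
Unshelve. all: by end_near. Qed.

(** Otherwise [F] would be nonzero near 0, so a whole ball would reduce to its center; the point
    [e / 2] refutes this. *)
Lemma cont0_punctured F : cont0 F -> (\forall z \near (0 : K^o), z != 0 -> F z = 0) -> F 0 = 0.
Proof.
move=> cF F0; apply/eqP; apply: contraPT isT => Fn.
have H := near_cont0_neq0 cF Fn.
have : \forall z \near (0 : K^o), z = 0.
  near=> z; apply/eqP; apply: contraT => zn.
  have : F z != 0 by near: z.
  by rewrite (near F0 z)// eqxx.
case/nbhs_ballP => e /= e0 /(_ (e / 2)).
rewrite -ball_normE /= sub0r normrN gtr0_norm ?divr_gt0//.
rewrite ltr_pdivrMr// ltr_pMr// ltr1n => /(_ isT) /eqP.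
by rewrite mulf_eq0 invr_eq0 pnatr_eq0 orbF gt_eqF.
Unshelve. all: by end_near. Qed.

(** Carathéodory's form of differentiability: the slope, completed by the derivative at 0. *)
Lemma derivable_slope F : derivable F 0 1 -> exists2 v : K^o -> K^o, cont0 v &
  forall z, F z = F 0 + z * v z.
Proof.
move=> dF; exists (fun z => if z == 0 then 'D_1 F 0 else (F z - F 0) / z).
  rewrite /cont0 /prop_for /continuous_at eqxx.
  apply/(@cvgrPdist_le _ K^o _ _ (nbhs_filter (0 : K^o))) => e e0; have [d d0 dP] := derivable_near dF e0.
  near=> z; case: eqVneq => [_|zn]; first by rewrite subrr normr0 ltW.
  have nz : 0 < `|z| by rewrite normr_gt0.
  rewrite -(ler_pM2r nz) -normrM.
  have -> : ('D_1 F 0 - (F z - F 0) / z) * z = - (F z - F 0 - 'D_1 F 0 * (z - 0)).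
    by field.
  rewrite normrN -[X in _ * `|X|]subr0; apply: dP; rewrite subr0.
  near: z; apply/nbhs_ballP; exists d => // z.
  by rewrite -ball_normE /= sub0r normrN.
move=> z; case: eqVneq => [->|zn]; first by rewrite mul0r addr0.
by field.
Unshelve. all: by end_near. Qed.

(* Differentiability of [u] lets one solve [F (u z) = c0 + z d1 + ...] for the
   second-order jet of [u]. *)
Lemma jet2_inverse F u c0 c1 c2 d1 d2 : c1 != 0 -> jet2 F c0 c1 c2 ->
  derivable u 0 1 -> u 0 = 0 -> jet2 (fun z => F (u z)) c0 d1 d2 ->
  jet2 u 0 (d1 / c1) ((d2 - c2 * (d1 / c1) ^+ 2) / c1).
Proof.
move=> c1n [r [cr r0 FE]] du u0 [s [cs s0 GE]].
have cu := derivable_cont0 du.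
have [v cv vE] := derivable_slope du.
have {}vE z : u z = z * v z by rewrite vE u0 add0r.
have cru : cont0 (fun z => r (u z)) by apply: cont0_comp.
have FG : \forall z \near (0 : K^o), F (u z) = c0 + u z * c1 + u z ^+ 2 * r (u z).
  exact: cont0_near FE.
(* Equate the two expansions of [F (u z)] and cancel a factor [z]; continuity then gives the value
   at 0. *)
have E : \forall z \near (0 : K^o), z != 0 ->
    v z * c1 - d1 + z * (v z ^+ 2 * r (u z) - s z) = 0.
  near=> z => zn; apply: (mulfI zn); rewrite mulr0.
  have h1 : F (u z) = c0 + u z * c1 + u z ^+ 2 * r (u z) by near: z.
  have : F (u z) = c0 + z * d1 + z ^+ 2 * s z by near: z.
  by rewrite h1 !vE => /eqP; rewrite -subr_eq0 => /eqP <-; ring.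
have v0 : v 0 = d1 / c1.
  have := cont0_punctured (F := fun z => v z * c1 - d1 + z * (v z ^+ 2 * r (u z) - s z)).
  rewrite mul0r addr0 => H; apply: (mulIf c1n); rewrite divfK//; apply/eqP.
  by rewrite -subr_eq0; apply/eqP; apply: H => //; cont.
exists (fun z => (s z - v z ^+ 2 * r (u z)) / c1); split.
- by cont.
- by rewrite v0 s0 u0 r0; congr (_ / _); ring.
near=> z; rewrite [LHS]vE add0r.
have [->|zn] := eqVneq z 0; first by rewrite !mul0r expr0n mul0r addr0.
have Ez : v z * c1 - d1 + z * (v z ^+ 2 * r (u z) - s z) = 0 by move: zn; near: z.
have vz : v z = (d1 - z * (v z ^+ 2 * r (u z) - s z)) / c1.
  apply: (mulIf c1n); rewrite divfK//; apply/eqP; rewrite -subr_eq0 -Ez.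
  by apply/eqP; ring.
by rewrite [LHS](congr1 (fun t => z * t) vz) /=; field.
Unshelve. all: by end_near. Qed.

Lemma derive_comp F G (z : K^o) : derivable G z 1 -> derivable F (G z) 1 ->
  derivable (fun y => F (G y)) z 1 /\
  'D_1 (fun y => F (G y)) z = 'D_1 F (G z) * 'D_1 G z.
Proof.
move=> /derivable1_diffP dG /derivable1_diffP dF.
have dFG : differentiable (F \o G) z by exact: differentiable_comp.
split; first exact/derivable1_diffP.
rewrite (deriveE _ dFG) (deriveE _ dG) (deriveE _ dF) diff_comp//=.
by rewrite -[X in 'd F (G z) X = _]mulr1 [RHS]mulrC linearZ_LR.
Qed.

End Jets.

(** * Power series *)

Section PowerSeries.
Variable R : realType.
Local Notation C := ((R[i])^o).
Implicit Types (u : nat -> R[i]) (L : R[i]).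

Lemma ccvgP u L : ((u : nat -> C) @ \oo --> (L : C)) <->
  forall e : R, 0 < e -> exists N, forall n, (N <= n)%N -> normc (u n - L) <= e.
Proof.
split=> [/cvgrPdist_le H e e0|H].
  have eC : 0 < e%:C by rewrite ltcR.
  have [N _ NP] := H _ eC; exists N => n Nn.
  by have := NP _ Nn; rewrite /= normc_norm lecR -normcN opprB.
apply/cvgrPdist_le => e e0.
have [eE /H[N NP]] := gt0_ReE e0.
exists N => // n /= Nn; rewrite distrC normc_norm eE lecR; exact: NP.
Qed.

Lemma ccvg_normc_le u L (M : R) : ((u : nat -> C) @ \oo --> (L : C)) ->
  (forall n, normc (u n) <= M) -> normc L <= M.
Proof.
move=> /ccvgP uL uM; apply/ler_addgt0Pr => e e0.
have [N /(_ N (leqnn N)) NP] := uL _ e0.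
have -> : L = u N - (u N - L) by ring.
apply: le_trans (le_normcD _ _) _; rewrite normcN; have := uM N; lra.
Qed.

Lemma ccvg_unique u L L' : ((u : nat -> C) @ \oo --> (L : C)) ->
  ((u : nat -> C) @ \oo --> (L' : C)) -> L = L'.
Proof. by move=> /cvg_lim <-// /cvg_lim <-. Qed.

Lemma ccvgD u v L L' : ((u : nat -> C) @ \oo --> (L : C)) ->
  ((v : nat -> C) @ \oo --> (L' : C)) ->
  ((fun n => u n + v n) : nat -> C) @ \oo --> (L + L' : C).
Proof. exact: (@cvgD _ C). Qed.

Lemma ccvgZ (c : R[i]) u L : ((u : nat -> C) @ \oo --> (L : C)) ->
  ((fun n => c * u n) : nat -> C) @ \oo --> (c * L : C).
Proof. by move=> uL; apply: (@cvgMl_tmp R[i] nat). Qed.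

Lemma ccvg_shift u L : ((u : nat -> C) @ \oo --> (L : C)) ->
  ((fun n => u n.+1) : nat -> C) @ \oo --> (L : C).
Proof.
move=> /ccvgP H; apply/ccvgP => e /H[N NP]; exists N => n Nn.
by apply: NP; exact: leqW.
Qed.

Lemma normc_ReIm (z : R[i]) : `|complex.Re z| <= normc z /\ `|complex.Im z| <= normc z.
Proof.
by case: z => a b /=; split; rewrite -sqrtr_sqr ler_wsqrtr// (lerDl, lerDr) sqr_ge0.
Qed.

Lemma normc_series_le u (K : R) n : 0 <= K -> (forall n, normc (u n) <= K * 2^-1 ^+ n) ->
  normc (series u n) <= 2 * K.
Proof.
move=> K0 uK; suff : normc (series u n) <= 2 * K - 2 * K * 2^-1 ^+ n.
  by move/le_trans; apply; rewrite gerBl mulr_ge0 ?exprn_ge0//; lra.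
elim: n => [|n IH]; first by rewrite /series /= big_geq// normc0 expr0; lra.
rewrite seriesSr; apply: le_trans (le_normcD _ _) _.
have := uK n; rewrite exprS; lra.
Qed.

Lemma geometric_cvg u (K : R) : 0 <= K -> (forall n, normc (u n) <= K * 2^-1 ^+ n) ->
  exists2 L, ((series u : nat -> C) @ \oo --> (L : C)) & normc L <= 2 * K.
Proof.
move=> K0 uK.
have rcvg (v : nat -> R) : (forall n, `|v n| <= K * 2^-1 ^+ n) -> cvgn (series v).
  move=> vK; apply: normed_cvg; apply: (series_le_cvg _ _ vK) => //.
  - by move=> n; rewrite mulr_ge0// exprn_ge0.
  - by apply: is_cvg_geometric_series; rewrite ger0_norm; lra.
have /rcvg cx : forall n, `|complex.Re (u n)| <= K * 2^-1 ^+ n.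
  by move=> n; apply: le_trans (uK n); case: (normc_ReIm (u n)).
have /rcvg cy : forall n, `|complex.Im (u n)| <= K * 2^-1 ^+ n.
  by move=> n; apply: le_trans (uK n); case: (normc_ReIm (u n)).
pose x := limn (series (fun n => complex.Re (u n))).
pose y := limn (series (fun n => complex.Im (u n))).
have cv : (series u : nat -> C) @ \oo --> (x +i* y : C).
  apply/ccvgP => e e0; have e2 : 0 < e / 2 by lra.
  have /cvgrPdist_le/(_ _ e2)[N1 _ H1] := cx.
  have /cvgrPdist_le/(_ _ e2)[N2 _ H2] := cy.
  exists (maxn N1 N2) => n; rewrite geq_max => /andP[n1 n2].
  have -> : series u n - (x +i* y) =
    (series (fun n => complex.Re (u n)) n - x) +i* (series (fun n => complex.Im (u n)) n - y).
    rewrite /series /=; elim: n {n1 n2} => [|n IH].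
      by rewrite !big_geq// !sub0r.
    rewrite !big_nat_recr//= addrAC IH.
    case: (u n) => a b; apply/eqP; rewrite eq_complex /=.
    by apply/andP; split; apply/eqP; ring.
  apply: le_trans (normc_le _ _) _.
  move: (H1 n n1) (H2 n n2) => /=; rewrite -/x -/y (distrC x) (distrC y); lra.
exists (x +i* y) => //; apply: ccvg_normc_le cv _ => n.
exact: normc_series_le.
Qed.

Definition PS u (z : C) : C := limn (series (fun n => u n * z ^+ n) : nat -> C).

(** For [normc z <= (2 * M)^-1] the terms of the series are then at most [K * 2^-1 ^+ n]. *)
Definition geo (K M : R) u := forall n, normc (u n) <= K * M ^+ n.

Lemma normcX (z : R[i]) n : normc (z ^+ n) = normc z ^+ n.
Proof. by elim: n => [|n IH]; rewrite ?normc1// !exprS normcM IH. Qed.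

Lemma PS_cvg u (K M : R) (z : C) : 0 <= K -> 0 < M -> geo K M u -> normc z <= (2 * M)^-1 ->
  ((series (fun n => u n * z ^+ n) : nat -> C) @ \oo --> PS u z) /\ normc (PS u z) <= 2 * K.
Proof.
move=> K0 M0 uK zM.
have [|L LP LK] := @geometric_cvg (fun n => u n * z ^+ n) K K0.
  move=> n; rewrite normcM normcX.
  have -> : 2^-1 ^+ n = M ^+ n * (2 * M)^-1 ^+ n :> R.
    by rewrite -exprMn; congr (_ ^+ _); field; rewrite gt_eqF.
  rewrite mulrA; apply: ler_pM; rewrite ?exprn_ge0 ?normc_ge0//.
  by apply: lerXn2r => //; rewrite nnegrE ?normc_ge0// invr_ge0 mulr_ge0// ltW.
by rewrite /PS; move/cvg_lim: (LP) => -> //.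
Qed.

Lemma geo_shift K M u : geo K M u -> geo (K * M) M (fun n => u n.+1).
Proof. by move=> uK n; rewrite -mulrA -exprS. Qed.

Lemma PS_shift u (K M : R) (z : C) : 0 <= K -> 0 < M -> geo K M u -> normc z <= (2 * M)^-1 ->
  PS u z = u 0%N + z * PS (fun n => u n.+1) z.
Proof.
move=> K0 M0 uK zM; have [c1 _] := PS_cvg K0 M0 uK zM.
have KM0 : 0 <= K * M by rewrite mulr_ge0// ltW.
have [c2 _] := PS_cvg KM0 M0 (geo_shift uK) zM.
apply: (@ccvg_unique (fun n => series (fun n => u n * z ^+ n) n.+1)).
  exact: ccvg_shift c1.
rewrite (_ : (fun n => _) = fun n => u 0%N + z * series (fun n => u n.+1 * z ^+ n) n).
  have cu0 : (((fun=> u 0%N) : nat -> C) @ \oo --> (u 0%N : C)) by exact: cvg_cst.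
  exact (@ccvgD _ _ _ _ cu0 (@ccvgZ z _ _ c2)).
apply/funext => n; rewrite /series /= big_nat_recl//= expr0 mulr1; congr (_ + _).
by rewrite mulr_sumr; apply: eq_bigr => i _; rewrite exprS; ring.
Qed.

Lemma near0_normc (d : R) : 0 < d -> \forall z \near (0 : C), normc z < d.
Proof.
move=> d0; apply/nbhs_ballP; exists d%:C; first by rewrite /= ltcR.
by move=> z; rewrite -ball_normE /= sub0r normrN normc_norm ltcR.
Qed.

Lemma cont0_normc (F : C -> C) : (forall e : R, 0 < e -> exists2 d : R, 0 < d &
  forall z, normc z < d -> normc (F z - F 0) <= e) -> cont0 F.
Proof.
move=> H; apply/(@cvgrPdist_le _ C _ _ (nbhs_filter (0 : C))) => e e0.
have [eE /H[d d0 dP]] := gt0_ReE e0.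
near=> z; rewrite distrC normc_norm eE lecR; apply: dP; near: z; exact: near0_normc.
Unshelve. all: by end_near. Qed.

Lemma PS_cont0 u (K M : R) : 0 <= K -> 0 < M -> geo K M u -> cont0 (PS u).
Proof.
move=> K0 M0 uK; have M2 : 0 < (2 * M)^-1 by rewrite invr_gt0 mulr_gt0.
have KM0 : 0 <= K * M by rewrite mulr_ge0// ltW.
apply: cont0_normc => e e0.
have e'0 : 0 < e / (2 * (K * M) + 1) by rewrite divr_gt0//; lra.
exists (Num.min (2 * M)^-1 (e / (2 * (K * M) + 1))); first by rewrite lt_min M2.
move=> z; rewrite lt_min => /andP[/ltW z1 z2].
rewrite (PS_shift K0 M0 uK z1) (PS_shift K0 M0 uK); last by rewrite normc0 ltW.
rewrite mul0r addr0 addrC addKr normcM.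
have [_] := PS_cvg KM0 M0 (geo_shift uK) z1.
move: z2; rewrite ltr_pdivlMr; last lra.
by have := normc_ge0 z; have := normc_ge0 (PS (fun n => u n.+1) z); nra.
Qed.

Lemma PS_jet2 u (K M : R) : 0 <= K -> 0 < M -> geo K M u ->
  jet2 (PS u) (u 0%N) (u 1%N) (u 2%N).
Proof.
move=> K0 M0 uK; have M2 : 0 < (2 * M)^-1 by rewrite invr_gt0 mulr_gt0.
have K1 : 0 <= K * M by rewrite mulr_ge0// ltW.
have K2 : 0 <= K * M * M by rewrite mulr_ge0// ltW.
have u1 := geo_shift uK; have u2 := geo_shift u1.
exists (PS (fun n => u n.+2)); split; first exact: PS_cont0 u2.
  by rewrite (PS_shift K2 M0 u2) ?mul0r ?addr0// normc0 ltW.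
near=> z; have z1 : normc z <= (2 * M)^-1 by apply/ltW; near: z; exact: near0_normc.
by rewrite (PS_shift K0 M0 uK z1) (PS_shift K1 M0 u1 z1); ring.
Unshelve. all: by end_near. Qed.

Definition dcoef u n : R[i] := n.+1%:R * u n.+1.

Lemma normc_nat n : normc (n%:R : R[i]) = n%:R :> R.
Proof. by rewrite -(rmorph_nat (real_complex R)) normcR ger0_norm. Qed.

(** Since [n.+1 <= 2 ^ n], doubling the ratio absorbs the factor from differentiation. *)
Lemma geo_dcoef K M u : 0 <= K -> 0 < M -> geo K M u -> geo (K * M) (2 * M) (dcoef u).
Proof.
move=> K0 M0 uK n; rewrite /dcoef normcM normc_nat.
have -> : K * M * (2 * M) ^+ n = 2 ^+ n * (K * M ^+ n.+1) by rewrite exprMn exprS; ring.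
apply: ler_pM; rewrite ?normc_ge0//.
by rewrite -natrX ler_nat ltn_expl.
Qed.

(** A crude second-order remainder, geometric in [i] so that it can be summed. In the induction step
    both terms get the same bound, whence the factor 2. *)
Lemma taylor_monomial (y z : R[i]) (rho : R) i : 0 < rho ->
  normc y <= rho -> normc z <= rho ->
  normc (y ^+ i.+1 - z ^+ i.+1 - (y - z) * (i.+1%:R * z ^+ i)) <=
  normc (y - z) ^+ 2 * rho^-1 * (2 * rho) ^+ i.
Proof.
move=> r0 yr zr; elim: i => [|i IH].
  rewrite !expr1 !expr0 !mulr1 subrr normc0 mulr_ge0//.
  by rewrite exprn_ge0// normc_ge0.
  by rewrite invr_ge0 ltW.
have -> : y ^+ i.+2 - z ^+ i.+2 - (y - z) * (i.+2%:R * z ^+ i.+1) =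
  y * (y ^+ i.+1 - z ^+ i.+1 - (y - z) * (i.+1%:R * z ^+ i)) + i.+1%:R * z ^+ i * (y - z) ^+ 2.
  by rewrite -[i.+2%:R]natr1 !exprS; ring.
apply: le_trans (le_normcD _ _) _; rewrite !normcM !normcX normc_nat.
set d := normc (y - z); set q := normc (_ - _) in IH *.
have h1 : normc y * q <= rho * (d ^+ 2 * rho^-1 * (2 * rho) ^+ i).
  by apply: ler_pM; rewrite ?normc_ge0.
have h2 : i.+1%:R * normc z ^+ i * d ^+ 2 <= 2 ^+ i * rho ^+ i * d ^+ 2.
  apply: ler_wpM2r; first by rewrite exprn_ge0 ?normc_ge0.
  apply: ler_pM; rewrite ?exprn_ge0 ?normc_ge0//.
    by rewrite -natrX ler_nat ltn_expl.
  by apply: lerXn2r => //; rewrite nnegrE ?normc_ge0 ?ltW.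
apply: le_trans (lerD h1 h2) _.
rewrite le_eqVlt; apply/orP; left; apply/eqP; rewrite !exprMn !exprS.
by field; rewrite gt_eqF.
Qed.

Lemma PS_taylor u (K M : R) (y z : C) : 0 <= K -> 0 < M -> geo K M u ->
  normc y <= (8 * M)^-1 -> normc z <= (8 * M)^-1 ->
  normc (PS u y - PS u z - PS (dcoef u) z * (y - z)) <= 16 * K * M ^+ 2 * normc (y - z) ^+ 2.
Proof.
move=> K0 M0 uK yM zM; set rho := (8 * M)^-1 in yM zM.
have r0 : 0 < rho by rewrite invr_gt0 mulr_gt0.
have r2 : rho <= (2 * M)^-1 by rewrite lef_pV2 ?posrE; lra.
have r4 : rho <= (2 * (2 * M))^-1 by rewrite lef_pV2 ?posrE; lra.
have [cy _] := PS_cvg K0 M0 uK (le_trans yM r2).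
have [cz _] := PS_cvg K0 M0 uK (le_trans zM r2).
have K1 : 0 <= K * M by rewrite mulr_ge0// ltW.
have M1 : 0 < 2 * M by lra.
have [cd _] := PS_cvg K1 M1 (geo_dcoef K0 M0 uK) (le_trans zM r4).
(* The shift aligns [u i.+1] with [dcoef u i]; the constant terms cancel in the difference. *)
move: cy cz => /ccvg_shift cy /ccvg_shift cz.
have cv := @ccvgD _ _ _ _ (@ccvgD _ _ _ _ cy (@ccvgZ (-1) _ _ cz)) (@ccvgZ (- (y - z)) _ _ cd).
have E (p q s t : R[i]) : p - q - s * t = p + -1 * q + - t * s by ring.
rewrite E.
apply: ccvg_normc_le cv _ => n.
set v := fun i => u i.+1 * (y ^+ i.+1 - z ^+ i.+1 - (y - z) * (i.+1%:R * z ^+ i)).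
have -> : 16 * K * M ^+ 2 * normc (y - z) ^+ 2 = 2 * (8 * K * M ^+ 2 * normc (y - z) ^+ 2) by ring.
suff -> : series (fun i => u i * y ^+ i) n.+1 + -1 * series (fun i => u i * z ^+ i) n.+1 +
   - (y - z) * series (fun i => dcoef u i * z ^+ i) n = series v n.
  have c0 : 0 <= 8 * K * M ^+ 2 * normc (y - z) ^+ 2.
    by apply: mulr_ge0; [apply: mulr_ge0; [lra|exact: sqr_ge0]|exact: sqr_ge0].
  apply: normc_series_le => // i.
  rewrite normcM.
  have := taylor_monomial i r0 yM zM; set q := normc (_ - _ - _) => hq.
  have : normc (u i.+1) * q <= K * M ^+ i.+1 * (normc (y - z) ^+ 2 * rho^-1 * (2 * rho) ^+ i).
    by apply: ler_pM; rewrite ?normc_ge0.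
  move/le_trans; apply.
  have -> : K * M ^+ i.+1 * (normc (y - z) ^+ 2 * rho^-1 * (2 * rho) ^+ i) =
     8 * K * M ^+ 2 * normc (y - z) ^+ 2 * (M * (2 * rho)) ^+ i.
    by rewrite [in RHS]exprMn exprS {1}/rho invrK; move: ((2 * rho) ^+ i) => X; ring.
  apply: ler_wpM2l => //.
  have -> : M * (2 * rho) = 4^-1 by rewrite /rho; field; rewrite gt_eqF.
  by apply: lerXn2r; rewrite ?nnegrE//; lra.
rewrite /series /=; elim: n => [|n IH].
  by rewrite !big_nat1 !big_geq// !expr0; ring.
have S (w : nat -> R[i]) m : \sum_(0 <= i < m.+1) w i = \sum_(0 <= i < m) w i + w m.
  by rewrite big_nat_recr.
rewrite (S (fun i => u i * y ^+ i)) (S (fun i => u i * z ^+ i)) (S v).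
rewrite (S (fun i => dcoef u i * z ^+ i)) -IH /v /dcoef.
set sy := \sum_(_ <= _ < _) _; set sz := \sum_(_ <= _ < _) _; set sd := \sum_(_ <= _ < _) _.
clearbody sy sz sd; ring.
Qed.

End PowerSeries.

(** * Term-by-term differentiation of power series *)

Section PSDerive.
Variable R : realType.
Local Notation C := ((R[i])^o).
Implicit Types (u : nat -> R[i]).

Lemma quadratic_is_derive (F : C -> C) (z D : C) (B d : R) : 0 < d -> 0 <= B ->
  (forall y, normc (y - z) < d -> normc (F y - F z - D * (y - z)) <= B * normc (y - z) ^+ 2) ->
  is_derive z 1 F D.
Proof.
move=> d0 B0 FD.
have cF : h^-1 *: ((F \o shift z) (h *: (1 : C)) - F z) @[h --> (0 : C)^'] --> (D : C).
  apply/cvgrPdist_le => e e0.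
  have [eE re0] := gt0_ReE e0.
  have e'0 : 0 < complex.Re e / (B + 1) by rewrite divr_gt0//; lra.
  rewrite near_withinE; near=> h => h0.
  have h1 : normc h < d by near: h; exact: near0_normc.
  have h2 : normc h < complex.Re e / (B + 1) by near: h; exact: near0_normc.
  have nh : 0 < normc h.
    by rewrite lt_neqAle normc_ge0 andbT eq_sym; apply: contra h0 => /eqP/eq0_normc ->.
  rewrite normc_norm eE lecR /shift /= [_ *: 1]mulr1.
  have -> : D - h^-1 *: (F (h + z) - F z) = - (h^-1 * (F (h + z) - F z - D * (h + z - z))).
    by rewrite addrK /GRing.scale /=; field.
  rewrite normcN normcM normcV mulrC ler_pdivrMr//.
  have := FD (h + z); rewrite !addrK => /(_ h1) => H; apply: le_trans H _.
  by move: h2; rewrite ltr_pdivlMr; [nra|lra].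
by split; [apply/cvg_ex; exists D|apply/cvg_lim].
Unshelve. all: by end_near. Qed.

Lemma PS_is_derive u (K M : R) : 0 <= K -> 0 < M -> geo K M u ->
  \forall z \near (0 : C), is_derive (z : C) 1 (PS u) (PS (dcoef u) z).
Proof.
move=> K0 M0 uK; have M8 : 0 < (16 * M)^-1 by rewrite invr_gt0 mulr_gt0.
(* Half the radius of [PS_taylor], so that points [y] this close to [z] stay in its disc. *)
have M16 : (16 * M)^-1 + (16 * M)^-1 = (8 * M)^-1 by field; rewrite gt_eqF.
near=> z; have z1 : normc z < (16 * M)^-1 by near: z; exact: near0_normc.
apply: (@quadratic_is_derive _ _ _ (16 * K * M ^+ 2) (16 * M)^-1) => //.
  by rewrite !mulr_ge0// ?exprn_ge0// ltW.
move=> y yz; apply: PS_taylor => //; last lra.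
by have := le_normcD (y - z) z; rewrite subrK; lra.
Unshelve. all: by end_near. Qed.

Lemma near_derive_eq (F G H : C -> C) : (\forall z \near (0 : C), F z = G z) ->
  (\forall z \near (0 : C), is_derive (z : C) 1 G (H z)) ->
  \forall z \near (0 : C), derivable F z 1 /\ 'D_1 F z = H z.
Proof.
move=> FG GH; have FG' : \forall z \near (0 : C), \forall y \near z, F y = G y.
  by apply: nbhs_interior.
near=> z; have e : \forall y \near z, F y = G y by near: z.
have e' : \forall y \near z, G y = F y by apply: filterS e.
have [dG <-] : is_derive (z : C) 1 G (H z) by near: z.
split; first exact: near_eq_derivable dG.
exact: near_eq_derive.
Unshelve. all: by end_near. Qed.

(** Convergence at [2^-1] makes the terms tend to 0: 1 bounds all but [N] of them, and the finite
    sum bounds the rest. *)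
Lemma power_series_geo u (F : C -> C) : power_series_on_U u F -> exists2 K : R, 0 <= K & geo K 2 u.
Proof.
move=> uF; have zU : udisk (2^-1 : C).
  by rewrite /udisk /= normfV invf_lt1 ?normr_gt0 ?pnatr_eq0// normr_nat ltr1n.
have /cvg_series_cvg_0 : cvgn (series (fun n => u n * (2^-1 : C) ^+ n) : nat -> C).
  by apply/cvg_ex; exists (F 2^-1); exact: uF.
move=> /ccvgP/(_ _ ltr01)[N NP].
have n2 : normc (2^-1 : R[i]) = 2^-1.
  by rewrite normcV (_ : 2 = (2:R)%:C) ?normcR ?ger0_norm// rmorph_nat.
exists (1 + \sum_(i < N) normc (u i) / 2 ^+ i).
  by rewrite addr_ge0// sumr_ge0// => i _; rewrite divr_ge0 ?normc_ge0 ?exprn_ge0.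
move=> n; rewrite -ler_pdivrMr ?exprn_gt0//.
have s0 : 0 <= \sum_(i < N) normc (u i) / 2 ^+ i.
  by rewrite sumr_ge0// => i _; rewrite divr_ge0 ?normc_ge0 ?exprn_ge0.
have [Nn|nN] := leqP N n.
  by have := NP _ Nn; rewrite subr0 normcM normcX n2 exprVn; lra.
rewrite (bigD1 (Ordinal nN))//= addrCA lerDl addr_ge0// sumr_ge0// => i _.
by rewrite divr_ge0 ?normc_ge0 ?exprn_ge0.
Qed.

Lemma power_series_jets u (F : C -> C) : power_series_on_U u F ->
  [/\ jet2 F (u 0%N) (u 1%N) (u 2%N),
      \forall z \near (0 : C), derivable F z 1 /\ derivable ('D_1 F) z 1,
      jet2 ('D_1 F) (u 1%N) (2 * u 2%N) (3 * u 3%N) &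
      jet2 ('D_1 ('D_1 F)) (2 * u 2%N) (6 * u 3%N) (12 * u 4%N)].
Proof.
move=> uF; have [K K0 uK] := power_series_geo uF.
have l2 : 0 < 2 :> R by lra.
have l4 : 0 < 2 * 2 :> R by lra.
have K2 : 0 <= K * 2 by lra.
have K4 : 0 <= K * 2 * (2 * 2) by lra.
have uK1 := geo_dcoef K0 l2 uK.
have uK2 := geo_dcoef K2 l4 uK1.
have l8 : 0 < 2 * (2 * 2) :> R by lra.
have FE : \forall z \near (0 : C), PS u z = F z.
  near=> z; have z1 : normc z < (2 * 2)^-1 by near: z; apply: near0_normc; lra.
  have [c _] := PS_cvg K0 l2 uK (ltW z1).
  have zU : udisk z by rewrite /udisk /= normc_norm ltcR; lra.
  exact: ccvg_unique c (uF _ zU).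
have FE' : \forall z \near (0 : C), F z = PS u z by apply: filterS FE.
have D1 := near_derive_eq FE' (PS_is_derive K0 l2 uK).
have D1E : \forall z \near (0 : C), 'D_1 F z = PS (dcoef u) z by apply: filterS D1 => z [].
have D1E' : \forall z \near (0 : C), PS (dcoef u) z = 'D_1 F z by apply: filterS D1E.
have D2 := near_derive_eq D1E (PS_is_derive K2 l4 uK1).
have D2E' : \forall z \near (0 : C), PS (dcoef (dcoef u)) z = 'D_1 ('D_1 F) z.
  by apply: filterS D2 => z [].
split.
- exact: near_eq_jet2 (PS_jet2 K0 l2 uK) FE.
- by apply: filterS2 D1 D2 => z [dF _] [dF' _]; split.
- have := near_eq_jet2 (PS_jet2 K2 l4 uK1) D1E'.
  by rewrite {1}/dcoef mul1r.
- have := near_eq_jet2 (PS_jet2 K4 l8 uK2) D2E'.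
  have -> : dcoef (dcoef u) 0%N = 2 * u 2%N by rewrite /dcoef; ring.
  have -> : dcoef (dcoef u) 1%N = 6 * u 3%N by rewrite /dcoef; ring.
  by have -> : dcoef (dcoef u) 2%N = 12 * u 4%N by rewrite /dcoef; ring.
Unshelve. all: by end_near. Qed.

End PSDerive.

(** * Coefficients of the inverse function *)

Section InverseJets.
Variable K : numFieldType.
Implicit Types f g : K^o -> K^o.

Lemma jet2_convex_combination (l b2 b3 e : K) (D1 D2 : K^o -> K^o) :
  jet2 D1 1 (2 * b2) (3 * b3) -> jet2 D2 (2 * b2) (6 * b3) e ->
  jet2 (fun z => (1 - l) * D1 z + l * (1 + z * D2 z / D1 z))
    1 (2 * b2) ((3 + 3 * l) * b3 - 4 * l * b2 ^+ 2).
Proof.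
move=> j1 j2; have j3 := jet2M (jet2_id K) j2.
have j4 := jet2M j3 (jet2V (oner_neq0 _) j1).
have j5 := jet2M (@jet2_cst K l) (jet2D (@jet2_cst K 1) j4).
have := jet2D (jet2M (@jet2_cst K (1 - l)) j1) j5.
by congr jet2; field.
Qed.

(** Differentiating [f (g z) = z] gives [g' = 1 / f'(g)] and [g'' = - f''(g) / f'(g) ^+ 3] near 0,
    so all jets are read off from those of [f]. *)
Lemma near_inverse_jets f g (a2 a3 a4 : K) :
  (\forall z \near (0 : K^o), derivable f z 1 /\ derivable ('D_1 f) z 1) ->
  jet2 f 0 1 a2 -> jet2 ('D_1 f) 1 (2 * a2) (3 * a3) ->
  jet2 ('D_1 ('D_1 f)) (2 * a2) (6 * a3) a4 ->
  (\forall z \near (0 : K^o), derivable g z 1) -> g 0 = 0 ->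
  (\forall z \near (0 : K^o), f (g z) = z) ->
  jet2 ('D_1 g) 1 (2 * - a2) (3 * (2 * a2 ^+ 2 - a3)) /\
  exists e, jet2 ('D_1 ('D_1 g)) (2 * - a2) (6 * (2 * a2 ^+ 2 - a3)) e.
Proof.
move=> df jf jf1 jf2 dg g0 fg.
have dg0 : derivable g 0 1 by exact: nbhs_singleton dg.
have jg : jet2 g 0 1 (- a2).
  have gf : \forall z \near (0 : K^o), z = f (g z) by apply: filterS fg.
  have := jet2_inverse (oner_neq0 _) jf dg0 g0 (near_eq_jet2 (jet2_id K) gf).
  by congr jet2; field.
have cg := jet2_cont0 jg.
pose p z := 'D_1 f (g z).
have jp : jet2 p 1 (2 * a2) (3 * a3 - 2 * a2 ^+ 2).
  by have := jet2_comp jf1 jg; congr jet2; ring.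
have jpV : jet2 (fun z => (p z)^-1) 1 (2 * - a2) (3 * (2 * a2 ^+ 2 - a3)).
  by have := jet2V (oner_neq0 _) jp; congr jet2; field.
have p0 : \forall z \near (0 : K^o), p z != 0.
  by apply: near_cont0_neq0 (jet2_cont0 jp) _; rewrite (jet2_at0 jp) oner_neq0.
have dfg := cont0_near cg g0 df.
have fg' : \forall z \near (0 : K^o), \forall y \near z, f (g y) = y by exact: nbhs_interior.
have g1 : \forall z \near (0 : K^o), 'D_1 g z = (p z)^-1.
  near=> z.
  have [dfz _] : derivable f (g z) 1 /\ derivable ('D_1 f) (g z) 1 by near: z.
  have dgz : derivable g z 1 by near: z.
  have pz : p z != 0 by near: z.
  have fgz : \forall y \near z, f (g y) = y by near: z.
  have [_ E] := derive_comp dgz dfz.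
  have pg : p z * 'D_1 g z = 1.
    rewrite -E -[RHS](@derive_id K K^o z 1); exact: near_eq_derive.
  by apply: (mulfI pz); rewrite pg divff.
have g1' : \forall z \near (0 : K^o), \forall y \near z, 'D_1 g y = (p y)^-1.
  exact: nbhs_interior.
have g2 : \forall z \near (0 : K^o),
    - 1 * ((p z)^-1 * (p z)^-1 * (p z)^-1) * 'D_1 ('D_1 f) (g z) = 'D_1 ('D_1 g) z.
  near=> z.
  have [_ dfz] : derivable f (g z) 1 /\ derivable ('D_1 f) (g z) 1 by near: z.
  have dgz : derivable g z 1 by near: z.
  have pz : p z != 0 by near: z.
  have gz : 'D_1 g z = (p z)^-1 by near: z.
  have gpz : \forall y \near z, 'D_1 g y = (p y)^-1 by near: z.
  have [dp pE] := derive_comp dgz dfz.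
  have -> : 'D_1 ('D_1 g) z = 'D_1 (fun y => (p y)^-1) z by exact: near_eq_derive.
  rewrite (@deriveV _ _ p) // pE gz /GRing.scale /=.
  by field.
split; first by apply: near_eq_jet2 jpV _; apply: filterS g1.
have jV2 := jet2M (jet2M (@jet2_cst K (-1)) (jet2M (jet2M jpV jpV) jpV)) (jet2_comp jf2 jg).
have := near_eq_jet2 jV2 g2; set e := (X in jet2 _ _ _ X) => H.
by exists e; move: H; congr jet2; ring.
Unshelve. all: by end_near. Qed.

End InverseJets.

(** * Coefficient bounds under subordination *)

Section Coefficients.
Variable R : realType.
Local Notation C := ((R[i])^o).

(** By [schwarz_second], the modulus of [c] is at most the convex combination of [B 1] and [|B 2|]
    with weights [1 - normc w1 ^+ 2] and [normc w1 ^+ 2]. *)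
Lemma subordinate_second_coef (B : nat -> R) (phi P : C -> C) (b c : C) :
  admissible_phi B phi -> subordinate P phi -> jet2 P 1 b c ->
  normc c <= Num.max (B 1%N) `|B 2%N|.
Proof.
move=> [_ [_ [_ [phi0 [_ [_ [_ [psphi [B0 B1]]]]]]]]] [w [aw w0 wU Pw]] jP.
have [jphi _ _ _] := power_series_jets psphi.
have U0 : udisk (0 : C) by rewrite /udisk /= normr0.
have B1n : (B 1%N)%:C != 0 :> C by rewrite fmorph_eq0 gt_eqF.
have Pw' : \forall z \near (0 : C), P z = phi (w z).
  near=> z; apply: Pw; rewrite /udisk /= normc_norm ltcR; near: z; exact: near0_normc.
rewrite B0 in jphi.
have jw := jet2_inverse B1n jphi (aw _ U0) w0 (near_eq_jet2 jP Pw').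
have := schwarz_second aw wU jw.
set w1 := b / _; set w2 := (c - _) / _ => H.
have -> : c = (B 1%N)%:C * w2 + (B 2%N)%:C * w1 ^+ 2 by rewrite /w2 mulrC divfK// subrK.
apply: le_trans (le_normcD _ _) _.
rewrite normcM [normc (_ * w1 ^+ 2)]normcM normcX !normcR (gtr0_norm B1).
have M1 : B 1%N <= Num.max (B 1%N) `|B 2%N| by rewrite le_max lexx.
have M2 : `|B 2%N| <= Num.max (B 1%N) `|B 2%N| by rewrite le_max lexx orbT.
by have := normc_ge0 w2; have := sqr_ge0 (normc w1); nra.
Unshelve. all: by end_near. Qed.

End Coefficients.

Theorem theorem3p2 (R : realType) (lam : R) (B : nat -> R)
    (phi : (R[i])^o -> (R[i])^o) (a : nat -> (R[i])^o) (f g : (R[i])^o -> (R[i])^o) :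
  0 <= lam <= 1 ->
  admissible_phi B phi ->
  in_G lam phi a f g ->
  [/\ `|B 2%N| <= B 1%N -> `|a 2%N| <= (Num.sqrt (B 1%N / (3 - lam)))%:C,
      B 1%N <= `|B 2%N| -> `|a 2%N| <= (Num.sqrt (`|B 2%N| / (3 - lam)))%:C,
      `|B 2%N| <= B 1%N ->
         `|a 3%N - (4 * lam / (3 + 3 * lam))%:C * a 2%N ^+ 2| <= (B 1%N / (3 + 3 * lam))%:C &
      B 1%N <= `|B 2%N| ->
         `|a 3%N - (4 * lam / (3 + 3 * lam))%:C * a 2%N ^+ 2| <= (`|B 2%N| / (3 + 3 * lam))%:C].
Proof.
move=> /andP[l0 l1] aphi [[[a0 a1] psf [af uf] [ag ug] fg] sf sg].
have [jf df jf1 jf2] := power_series_jets psf.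
rewrite a0 a1 in jf jf1.
have U0 : udisk (0 : (R[i])^o) by rewrite /udisk /= normr0.
(* Both [g 0] and [0] lie in the disc and are sent to [0] by the univalent [f]. *)
have g0 : g 0 = 0.
  by have [gU fg0] := nbhs_singleton fg; apply: uf => //; rewrite fg0 (jet2_at0 jf).
have dg : \forall z \near (0 : (R[i])^o), derivable g z 1.
  near=> z; apply: ag; rewrite /udisk /= normc_norm ltcR; near: z; exact: near0_normc.
have fg' : \forall z \near (0 : (R[i])^o), f (g z) = z by apply: filterS fg => z [].
have [jg1 [e jg2]] := near_inverse_jets df jf jf1 jf2 dg g0 fg'.
have := subordinate_second_coef aphi sf (jet2_convex_combination lam%:C jf1 jf2).
have := subordinate_second_coef aphi sg (jet2_convex_combination lam%:C jg1 jg2).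
(* Working with the maximum [m] treats both cases of each estimate at once. *)
set m := Num.max _ _; set A' := _ - _; set A := (3 + _) * a 3%N - _ => hA' hA.
have n3l : 0 < 3 - lam by lra.
have p3l : 0 < 3 + 3 * lam by lra.
have h2 : `|a 2%N| <= (Num.sqrt (m / (3 - lam)))%:C.
  rewrite normc_norm lecR -[normc _]ger0_norm ?normc_ge0// -sqrtr_sqr ler_wsqrtr//.
  rewrite ler_pdivlMr//.
  have E : A + A' = (2 * (3 - lam))%:C * a 2%N ^+ 2.
    rewrite /A /A' rmorphM rmorphB /= !rmorph_nat; ring.
  have := le_normcD A A'; rewrite E normcM normcR normcX ger0_norm; lra.
have h3 : `|a 3%N - (4 * lam / (3 + 3 * lam))%:C * a 2%N ^+ 2| <= (m / (3 + 3 * lam))%:C.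
  rewrite normc_norm lecR ler_pdivlMr// -[X in _ * X <= _](gtr0_norm p3l).
  rewrite -[`|_ + _|]normcR -normcM.
  have -> : (a 3%N - (4 * lam / (3 + 3 * lam))%:C * a 2%N ^+ 2) * (3 + 3 * lam)%:C = A.
    have E : (3 + 3 * lam)%:C = 3 + 3 * lam%:C :> R[i] by rewrite rmorphD rmorphM /= !rmorph_nat.
    have n0 : 3 + 3 * lam%:C != 0 :> R[i] by rewrite -E fmorph_eq0 gt_eqF.
    rewrite rmorphM fmorphV rmorphM /= E !rmorph_nat /A; by field.
  exact: hA.
have m1 : `|B 2%N| <= B 1%N -> m = B 1%N by move/max_idPl.
have m2 : B 1%N <= `|B 2%N| -> m = `|B 2%N| by move/max_idPr.
by split=> [/m1 <-|/m2 <-|/m1 <-|/m2 <-].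
Unshelve. all: by end_near. Qed.
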